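(* Let $A$ be a unital simple separable infinite-dimensional C*-algebra, let $G$ be a second-countable compact group, and let $\alpha\colon G\to \mathrm{Aut}(A)$ be an action with the weak tracial Rokhlin property with comparison. Then the fixed point algebra $A^\alpha$ is simple.
   Context: Conventions. An action $\alpha\colon G\to\mathrm{Aut}(A)$ is a group homomorphism such that $g\mapsto\alpha_g(a)$ is norm continuous for every $a\in A$; $A^\alpha=\{a\in A:\alpha_g(a)=a\ \forall g\in G\}$. For a positive element $a$ and $\varepsilon>0$, $(a-\varepsilon)_+=f(a)$ with $f(t)=\max\{0,t-\varepsilon\}$. For a C*-algebra $B$ and $a,b\in (B\otimes K)_+$ ($K$ the compact operators on $\ell^2$, with $B\subset M_n(B)\subset B\otimes K$ as usual), $a\precsim_B b$ means there is a sequence $(r_n)$ in $B\otimes K$ with $\|r_n^*br_n-a\|\to 0$. On $C(G)$, $\mathrm{Lt}_g(f)(h)=f(g^{-1}h)$. Definition (weak tracial Rokhlin property with comparison). Let $G$ be a second-countable compact group, $A$ a unital simple infinite-dimensional C*-algebra, $\alpha\colon G\to\mathrm{Aut}(A)$ an action. $\alpha$ has the weak tracial Rokhlin property with comparison if for every $\varepsilon>0$, every finite set $F\subseteq A$, every finite set $S\subseteq C(G)$, every $x\in A_+$ with $\|x\|=1$, and every $y\in(A^\alpha)_+\setminus\{0\}$, there exist a positive contraction $d\in A^\alpha$ and a contractive completely positive map $\psi\colon C(G)\to\overline{dAd}$ such that: (1) $\|\psi(1)\psi(f_1f_2)-\psi(f_1)\psi(f_2)\|<\varepsilon$ for all $f_1,f_2\in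 S$; $\|\psi(f)a-a\psi(f)\|<\varepsilon$ for all $f\in S$, $a\in F$; and $\sup_{g\in G}\|\psi(\mathrm{Lt}_g(f))-\alpha_g(\psi(f))\|<\varepsilon$ for all $f\in S$; (2) $\psi(1)=d$; (3) $(1-d-\varepsilon)_+\precsim_A x$; (4) $(1-d-\varepsilon)_+\precsim_{A^\alpha} y$; (5) $(1-d-\varepsilon)_+\precsim_{A^\alpha} d$; (6) $\|dxd\|>1-\varepsilon$. *)

(* Defs.v *)
From HB Require Import structures.
From mathcomp Require Import all_boot all_order all_algebra complex.
From mathcomp Require Import all_classical all_reals all_analysis.
Import numFieldNormedType.Exports.
Import Order.TTheory GRing.Theory Num.Theory.

Set Implicit Arguments.
Unset Strict Implicit.
Unset Printing Implicit Defensive.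

Local Open Scope classical_set_scope.
Local Open Scope ring_scope.

HB.mixin Record isTopologicalGroup G & Group G & Topological G := {
  mulg_continuous : continuous (fun x : G * G => (x.1 * x.2)%g) ;
  invg_continuous : continuous (fun x : G => (x^-1)%g)
}.

#[short(type="topologicalGroupType")]
HB.structure Definition TopologicalGroup :=
  {G of Group G & Topological G & isTopologicalGroup G}.

(* Unital C*-algebras, with norm nrm and the uniform structure it induces.
   Since the ring structure is that of an nzRingType, the zero algebra is
   excluded.  Numeric domains being both rings and normed modules in the
   library, Hierarchy Builder does not let normedModType and algType be joined
   afterwards; hence the norm is a field here. *)
HB.mixin Record isCStar (R : realType) A & Uniform A & GRing.Algebra R[i] A := {
  nrm : A -> R ;
  star : A -> A ;
  nrm0_eq0 : forall a : A, nrm a = 0 -> a = 0 ;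
  nrmD : forall a b : A, nrm (a + b) <= nrm a + nrm b ;
  nrmZ : forall (z : R[i]) (a : A), nrm (z *: a) = complex.Re `|z| * nrm a ;
  nrmM : forall a b : A, nrm (a * b) <= nrm a * nrm b ;
  starK : involutive star ;
  starD : {morph star : a b / a + b} ;
  starZ : forall (z : R[i]) (a : A), star (z *: a) = z^* *: star a ;
  starM : forall a b : A, star (a * b) = star b * star a ;
  nrm_starM : forall a : A, nrm (star a * a) = nrm a ^+ 2 ;
  nrm_entourage : forall E : set (A * A), entourage E <->
    exists2 e : R, 0 < e & [set ab | nrm (ab.1 - ab.2) < e] `<=` E ;
  nrm_complete : forall F : set_system A, ProperFilter F -> cauchy F ->
    exists a : A, F --> a
}.

#[short(type="cstarType")]
HB.structure Definition CStar (R : realType) :=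
  {A of Uniform A & GRing.Algebra R[i] A & isCStar R A}.

Section CStarAlgebras.
Context {R : realType} {A : cstarType R}.
Implicit Types (a b c d : A) (B D I : set A) (eps : R).

(* C*-subalgebras of A are represented by their carriers B : set A; notions
   relative to B quantify over elements of B only. *)

Definition positive B a := exists2 x, B x & a = star x * x.

Definition adjmx m n (X : 'M[A]_(m, n)) : 'M[A]_(n, m) :=
  map_mx (@star R A) X^T.

Definition positive_mx B n (T : 'M[A]_n) :=
  exists2 X : 'M[A]_n, (forall i j, B (X i j)) & T = adjmx X *m X.

Definition closed_ideal B I :=
  [/\ I `<=` B, closed I, I 0,
      (forall (z : R[i]) x y, I x -> I y -> I (z *: x + y)) &
      (forall b x, B b -> I x -> I (b * x) /\ I (x * b))].

Definition simple_cstar B :=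
  B != [set 0] /\ forall I, closed_ideal B I -> I = [set 0] \/ I = B.

Definition infinite_dimensional :=
  ~ exists (n : nat) (v : 'I_n -> A),
      forall a, exists z : 'I_n -> R[i], a = \sum_(i < n) z i *: v i.

Definition spectrum a : set R[i]^o :=
  [set z : R[i]^o |
    ~ exists b, b * ((z : R[i])%:A - a) = 1 /\ ((z : R[i])%:A - a) * b = 1].

(* Phi is the continuous functional calculus of a, i.e. the isometric unital
   *-homomorphism C(sp a) -> A sending the inclusion sp a -> C to a.  Elements
   of C(sp a) are represented by functions on C continuous on sp a. *)
Record continuous_calculus a (Phi : (R[i]^o -> R[i]^o) -> A) : Prop := {
  calc_id : Phi id = a ;
  calc_1 : Phi (fun=> 1) = 1 ;
  calcD : forall f g : R[i]^o -> R[i]^o,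
    {within spectrum a, continuous f} -> {within spectrum a, continuous g} ->
    Phi (fun z => f z + g z) = Phi f + Phi g ;
  calcZ : forall (c : R[i]) (f : R[i]^o -> R[i]^o), {within spectrum a, continuous f} ->
    Phi (fun z => c * f z) = c *: Phi f ;
  calcM : forall f g : R[i]^o -> R[i]^o,
    {within spectrum a, continuous f} -> {within spectrum a, continuous g} ->
    Phi (fun z => f z * g z) = Phi f * Phi g ;
  calc_star : forall f : R[i]^o -> R[i]^o, {within spectrum a, continuous f} ->
    Phi (fun z => (f z)^*) = star (Phi f) ;
  calc_norm : forall f : R[i]^o -> R[i]^o, {within spectrum a, continuous f} ->
    (nrm (Phi f))%:E = ereal_sup [set (complex.Re `|f z|)%:E | z in spectrum a]
}.

(* c = f(a); for a normal such a c exists and is unique. *)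
Definition is_calculus a (f : R[i]^o -> R[i]^o) c :=
  exists2 Phi, continuous_calculus a Phi & c = Phi f.

(* c = (a - eps)_+, for a self-adjoint, so that sp a is real *)
Definition is_cutdown a eps c :=
  is_calculus a (fun z => (Num.max 0 (complex.Re z - eps))%:C%C) c.

(* B (x) K is realised as the algebra of infinite matrices over B that are
   norm limits of finitely supported ones; the norm is the operator norm on the
   standard Hilbert A-module, which on n x n matrices is the C*-norm of M_n. *)
Definition stab_norm (T : nat -> nat -> A) : \bar R :=
  ereal_sup [set e | exists n (x y : 'cV[A]_n),
    [/\ nrm ((adjmx x *m x) ord0 ord0) <= 1,
        nrm ((adjmx y *m y) ord0 ord0) <= 1 &
        e = (nrm ((adjmx y *m (\matrix_(i < n, j < n) T i j) *m x)
                    ord0 ord0))%:E]].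

Definition stab B (T : nat -> nat -> A) :=
  (forall i j, B (T i j)) /\
  forall eps, 0 < eps -> exists (n : nat) (S : nat -> nat -> A),
    [/\ forall i j, B (S i j),
        forall i j, (n <= i)%N || (n <= j)%N -> S i j = 0 &
        (stab_norm (fun i j => (T i j - S i j)%R) < eps%:E)%E].

(* The entries of a product are limits of sums in A; the default 0 is not used
   for elements of the stabilisation. *)
Definition stab_mul (S T : nat -> nat -> A) : nat -> nat -> A :=
  fun i j => xget 0 [set l | (fun n : nat => \sum_(k < n) S i k * T k j) @ \oo
                              --> l].

Definition stab_star (T : nat -> nat -> A) : nat -> nat -> A :=
  fun i j => star (T j i).

Definition stab_corner a : nat -> nat -> A :=
  fun i j => if (i == 0%N) && (j == 0%N) then a else 0.

Definition cuntz_sub B (S T : nat -> nat -> A) :=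
  exists2 r : nat -> nat -> nat -> A, forall n, stab B (r n) &
    (fun n => stab_norm (fun i j =>
       stab_mul (stab_mul (stab_star (r n)) T) (r n) i j - S i j)) @ \oo
      --> 0%E.

(* (a - eps)_+ and b are identified with their images in the (0,0) corner. *)
Definition cutdown_cuntz_sub B a eps b :=
  exists2 c, is_cutdown a eps c & cuntz_sub B (stab_corner c) (stab_corner b).

Definition dAd_closure d : set A := closure [set d * a * d | a in [set: A]].

End CStarAlgebras.

Arguments infinite_dimensional {R} A.

Definition separable (T : topologicalType) :=
  exists2 D : set T, countable D & dense D.

Notation CG R G := (continuousType G R[i]^o).

Section FunctionsOnG.
Context {R : realType} {G : topologicalGroupType}.
Implicit Types (f h : CG R G) (g : G).

Lemma CG_cst_continuous (z : R[i]) : continuous (fun _ : G => z : R[i]^o).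
Proof. by move=> x; exact: cvg_cst. Qed.

Lemma CG_add_continuous f h : continuous (fun x => f x + h x : R[i]^o).
Proof. by move=> x; apply: cvgD; exact: cts_fun. Qed.

Lemma CG_mul_continuous f h : continuous (fun x => f x * h x : R[i]^o).
Proof. by move=> x; apply: cvgM; exact: cts_fun. Qed.

Lemma CG_Lt_continuous g f : continuous (fun x => f (g^-1 * x)%g).
Proof.
move=> x; apply: (@continuous_comp _ _ _ (fun x : G => (g^-1 * x)%g) f);
  last exact: cts_fun.
apply: (@continuous_comp _ _ _ (fun x : G => (g^-1%g, x))
          (fun x : G * G => (x.1 * x.2)%g)); last exact: mulg_continuous.
by apply: cvg_pair; [exact: cvg_cst | exact: cvg_id].
Qed.

Definition CG_cst (z : R[i]) : CG R G := mkcts (@CG_cst_continuous z).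
Definition CG_add f h : CG R G := mkcts (@CG_add_continuous f h).
Definition CG_mul f h : CG R G := mkcts (@CG_mul_continuous f h).
Definition Lt g f : CG R G := mkcts (@CG_Lt_continuous g f).

Definition CG_norm f : \bar R :=
  ereal_sup [set (complex.Re `|f g|)%:E | g in [set: G]].

(* F = X^* X in M_n(C(G)) *)
Definition CG_positive_mx n (F : 'M[CG R G]_n) :=
  exists X : 'M[CG R G]_n, forall i j g,
    F i j g = \sum_(k < n) (X k i g)^* * X k j g.

End FunctionsOnG.

Section Actions.
Context {R : realType} {A : cstarType R} {G : topologicalGroupType}.

Record contractive_cp_map (D : set A) (psi : CG R G -> A) : Prop := {
  ccp_im : forall f, D (psi f) ;
  ccpD : forall f h, psi (CG_add f h) = psi f + psi h ;
  ccpZ : forall z f, psi (CG_mul (CG_cst z) f) = z *: psi f ;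
  ccp_contractive : forall f, ((nrm (psi f))%:E <= CG_norm f)%E ;
  ccp_positive : forall n (F : 'M[CG R G]_n),
    CG_positive_mx F -> positive_mx D (map_mx psi F)
}.

Record star_automorphism (phi : A -> A) : Prop := {
  saut_linear : linear phi ;
  saut_mul : {morph phi : a b / a * b} ;
  saut_star : {morph phi : a / star a} ;
  saut_bij : bijective phi
}.

Record is_action (alpha : G -> A -> A) : Prop := {
  action_aut : forall g, star_automorphism (alpha g) ;
  action_mul : forall g h a, alpha (g * h)%g a = alpha g (alpha h a) ;
  action_continuous : forall a, continuous (fun g => alpha g a)
}.

Definition fixed_algebra (alpha : G -> A -> A) : set A :=
  [set a | forall g, alpha g a = a].

Definition weak_tracial_Rokhlin_with_comparison (alpha : G -> A -> A) :=
  forall (eps : R) (F : set A) (S : set (CG R G)) (x y : A),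
    0 < eps -> finite_set F -> finite_set S ->
    positive setT x -> nrm x = 1 ->
    positive (fixed_algebra alpha) y -> y != 0 ->
  exists (d : A) (psi : CG R G -> A),
    [/\ positive (fixed_algebra alpha) d, nrm d <= 1 &
        contractive_cp_map (dAd_closure d) psi] /\
    [/\ [/\ forall f1 f2, S f1 -> S f2 ->
              nrm (psi (CG_cst 1) * psi (CG_mul f1 f2) - psi f1 * psi f2) < eps,
            forall f a, S f -> F a -> nrm (psi f * a - a * psi f) < eps &
            forall f, S f ->
              (ereal_sup [set (nrm (psi (Lt g f) - alpha g (psi f))%R)%:E
                         | g in [set: G]] < eps%:E)%E] /\
          psi (CG_cst 1) = d,
        cutdown_cuntz_sub setT (1 - d) eps x,
        cutdown_cuntz_sub (fixed_algebra alpha) (1 - d) eps y,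
        cutdown_cuntz_sub (fixed_algebra alpha) (1 - d) eps d &
        1 - eps < nrm (d * x * d)].

End Actions.

(* Main.v *)
(* Let I be a nonzero closed ideal of the fixed point algebra, and let
   0 <> y = z^* z be in I.  Since A is simple, 1 is close to a finite sum of terms
   a y c.  Take a partition of unity (f_i) of C(G) subordinate to neighbourhoods of
   points p_i that are small for the orbits of the a's and c's, and put
   T(x) = sum_i psi(f_i) alpha_(p_i)(x).  Then T(1) = d, T(a) y T(c) is close to
   d T(a y c), and T(a), T(c) are almost invariant, hence close to fixed elements
   (iterate finite averages over G); so d^2 is close to I.  As (1 - d - eps)_+ is
   Cuntz below y, it lies in I, so 1 = (1 - d)(1 + d) + d^2 is close to I, whence
   1 is in I.

   All estimates on T reduce to: if sum_i f_i <= 1 and ||x_i|| <= delta, then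
   ||sum_i psi(f_i) x_i|| is asymptotically at most 2 delta.  By the C*-identity the
   2^q-th power of this norm is controlled by a sum over words of length 2^q in the
   f_i; words with equal letter counts have the same product, and grouping them costs
   only a factor polynomial in 2^q, by contractivity of psi alone. *)
From HB Require Import structures.
Require Import Defs.
From mathcomp Require Import all_boot all_order all_algebra complex.
From mathcomp Require Import all_classical all_reals all_analysis.
From mathcomp Require Import ring lra zify.
Import numFieldNormedType.Exports.
Import Order.TTheory GRing.Theory Num.Theory.

Set Implicit Arguments.
Unset Strict Implicit.
Unset Printing Implicit Defensive.

Local Open Scope classical_set_scope.
Local Open Scope ring_scope.

(** * Consequences of the C*-identity for the norm and the involution *)

Section NormAndStar.
Context {R : realType} {A : cstarType R}.
Implicit Types a b : A.

Lemma nrm0 : nrm (0 : A) = 0.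
Proof. by rewrite -(scale0r (0 : A)) nrmZ normr0 mul0r. Qed.

Lemma nrmN a : nrm (- a) = nrm a.
Proof. by rewrite -scaleN1r nrmZ normrN normr1 mul1r. Qed.

Lemma nrm_ge0 a : 0 <= nrm a.
Proof.
have := nrmD a (- a); rewrite subrr nrm0 nrmN -mulr2n.
by rewrite pmulrn_lge0.
Qed.

Lemma nrmB a b : nrm (a - b) <= nrm a + nrm b.
Proof. by rewrite -(nrmN b) nrmD. Qed.

Lemma nrmBC a b : nrm (a - b) = nrm (b - a).
Proof. by rewrite -opprB nrmN. Qed.

Lemma nrm_triangle c a b : nrm (a - b) <= nrm (a - c) + nrm (c - b).
Proof. by rewrite -[a - b](subrKA c) nrmD. Qed.

Lemma nrmB_abs a b : `|nrm a - nrm b| <= nrm (a - b).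
Proof.
rewrite ler_norml; apply/andP; split.
  by have := nrm_triangle 0 b a; rewrite subr0 sub0r nrmN nrmBC; have := nrmD (b - a) a;
     rewrite subrK (nrmBC b); lra.
by have := nrmD (a - b) b; rewrite subrK; lra.
Qed.

Lemma nrm_sum (I : Type) (r : seq I) (P : pred I) (F : I -> A) :
  nrm (\sum_(i <- r | P i) F i) <= \sum_(i <- r | P i) nrm (F i).
Proof.
elim/big_ind2: _ => [|a x b y ax by'|//]; first by rewrite nrm0.
exact: le_trans (nrmD _ _) (lerD ax by').
Qed.

Lemma nrm_scale (r : R) a : nrm (r%:C%C *: a) = `|r| * nrm a.
Proof. by rewrite nrmZ normc_def /= expr0n addr0 sqrtr_sqr. Qed.

Lemma star0 : star (0 : A) = 0.
Proof. by apply: (@addrI _ (star 0)); rewrite -starD !addr0. Qed.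

Lemma starN a : star (- a) = - star a.
Proof. by apply/eqP; rewrite -addr_eq0 -starD addNr star0. Qed.

Lemma starB a b : star (a - b) = star a - star b.
Proof. by rewrite starD starN. Qed.

Lemma star_sum (I : Type) (r : seq I) (P : pred I) (F : I -> A) :
  star (\sum_(i <- r | P i) F i) = \sum_(i <- r | P i) star (F i).
Proof. exact: (big_morph _ (@starD R A) star0). Qed.

Lemma star1 : star (1 : A) = 1.
Proof. by rewrite -[RHS]starK -[X in _ = star X]mulr1 starM starK mulr1. Qed.

Lemma star_scale (r : R) a : star (r%:C%C *: a) = r%:C%C *: star a.
Proof. by rewrite starZ conj_Creal ?complex_real. Qed.

Lemma nrm_star a : nrm (star a) = nrm a.
Proof.
suff le b : nrm b <= nrm (star b) by apply/le_anti; rewrite le -{2}(starK a) le.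
have [->|b0] := eqVneq (nrm b) 0; first exact: nrm_ge0.
have bp : 0 < nrm b by rewrite lt_def b0 nrm_ge0.
by rewrite -(ler_pM2r bp) -expr2 -nrm_starM nrmM.
Qed.

Lemma nrm1 : nrm (1 : A) = 1.
Proof.
have n0 : nrm (1 : A) != 0.
  by apply/eqP => /nrm0_eq0/eqP; rewrite oner_eq0.
by apply: (mulfI n0); rewrite mulr1 -expr2 -nrm_starM star1 mulr1.
Qed.

Lemma nrmX a n : nrm (a ^+ n) <= nrm a ^+ n.
Proof.
elim: n => [|n IH]; first by rewrite !expr0 nrm1.
rewrite !exprS; apply: le_trans (nrmM _ _) _.
by apply: ler_wpM2l => //; exact: nrm_ge0.
Qed.

End NormAndStar.

(** * Neighbourhoods, closed sets and limits expressed by the norm *)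

Section NormTopology.
Context {R : realType} {A : cstarType R}.
Implicit Types a b : A.

Lemma nbhs_nrm a (U : set A) :
  nbhs a U <-> exists2 e : R, 0 < e & forall b, nrm (a - b) < e -> U b.
Proof.
rewrite -nbhs_entourageE; split.
  move=> [E /nrm_entourage[e e0 eE] EU]; exists e => // b ab.
  by apply: EU; apply/xsectionP; exact: (eE (a, b)).
move=> [e e0 eU].
exists [set ab | nrm (ab.1 - ab.2) < e].
  by apply/nrm_entourage; exists e.
by move=> b /xsectionP; exact: eU.
Qed.

Lemma continuous_nrm (T : topologicalType) (f : T -> A) (x : T) (e : R) :
  continuous f -> 0 < e -> \forall y \near x, nrm (f x - f y) < e.
Proof.
move=> cf e0; apply: (cf x [set b | nrm (f x - b) < e]).
by apply/nbhs_nrm; exists e.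
Qed.

Lemma closed_nrm (I : set A) : closed I <->
  forall a, (forall e : R, 0 < e -> exists2 x, I x & nrm (a - x) < e) -> I a.
Proof.
split=> [cI a h|h a ha].
  apply: cI; rewrite /closure /= => U /nbhs_nrm[e e0 eU].
  by have [x Ix ax] := h e e0; exists x; split=> //; exact: eU.
apply: h => e e0.
have [|x [Ix ax]] := ha [set b | nrm (a - b) < e]; last by exists x.
by apply/nbhs_nrm; exists e.
Qed.

Lemma nrm_small a : (forall e : R, 0 < e -> nrm a <= e) -> a = 0.
Proof.
move=> h; apply: nrm0_eq0; apply/le_anti; rewrite nrm_ge0 andbT.
by apply/ler_addgt0Pl => e e0; rewrite addr0; exact: h.
Qed.

Lemma nrm_cauchy (u : nat -> A) :
  (forall e : R, 0 < e -> exists N, forall n m, (N <= n)%N -> (N <= m)%N ->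
     nrm (u n - u m) < e) ->
  exists a, forall e : R, 0 < e -> \forall n \near \oo, nrm (u n - a) < e.
Proof.
move=> h; have [] := @nrm_complete R A (u @ \oo) _.
  move=> E /nrm_entourage[e e0 eE]; have [N hN] := h e e0.
  exists ([set u n | n in [set n | (N <= n)%N]], [set u n | n in [set n | (N <= n)%N]]) => /=.
    by split; exists N => // n Nn; exists n.
  by move=> [_ _] /= [[n Nn <-] [m Nm <-]]; apply: eE; exact: hN.
move=> a ua; exists a => e e0.
apply: (ua [set b | nrm (b - a) < e]); apply/nbhs_nrm; exists e => // b.
by rewrite nrmBC.
Qed.

Lemma geometric_small (K q e : R) : 0 <= q < 1 -> 0 < e ->
  \forall n \near \oo, K * q ^+ n < e.
Proof.
move=> /andP[q0 q1] e0; have : (fun n => K * q ^+ n) @ \oo --> K * (0 : R^o).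
  by apply: cvgMr; apply: cvg_expr; rewrite ger0_norm.
by rewrite mulr0 => /cvgr_lt; apply.
Qed.

Lemma nrm_geometric (u : nat -> A) (C q : R) : 0 <= q < 1 ->
  (forall n, nrm (u n.+1 - u n) <= C * q ^+ n) ->
  exists a, forall n, nrm (u n - a) <= C / (1 - q) * q ^+ n.
Proof.
move=> q01 h; have /andP[q0 q1] := q01.
have C0 : 0 <= C by have := h 0%N; rewrite expr0 mulr1; apply: le_trans; exact: nrm_ge0.
have q1' : 0 < 1 - q by rewrite subr_gt0.
pose D := C / (1 - q).
have D0 : 0 <= D by rewrite divr_ge0 // ltW.
(* The subtracted term makes the bound telescope, which closes the induction on k; [tel'] then drops
   it. *)
have tel n k : nrm (u (n + k)%N - u n) <= D * q ^+ n - D * q ^+ (n + k).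
  elim: k => [|k IH]; first by rewrite addn0 !subrr nrm0.
  apply: le_trans (nrm_triangle (u (n + k)%N) _ _) _.
  rewrite addnS; apply: le_trans (lerD (h _) IH) _.
  have -> : C = D * (1 - q) by rewrite /D mulfVK // gt_eqF.
  by rewrite exprS le_eqVlt; apply/orP; left; apply/eqP; ring.
have tel' n k : nrm (u (n + k)%N - u n) <= D * q ^+ n.
  by apply: le_trans (tel n k) _; rewrite gerBl mulr_ge0 // exprn_ge0.
have [|a ha] := @nrm_cauchy u.
  move=> e e0; have [N _ hN] := geometric_small D q01 (divr_gt0 e0 (ltr0n _ 2)).
  exists N => n m Nn Nm; apply: le_lt_trans (nrm_triangle (u N) _ _) _.
  have := hN N (leqnn N); have := tel' N (n - N)%N; have := tel' N (m - N)%N.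
  by rewrite !subnKC // (nrmBC (u N)) /=; lra.
exists a => n; apply/ler_addgt0Pl => e e0.
have [N _ hN] := ha e e0.
apply: le_trans (nrm_triangle (u (n + N)%N) _ _) _.
rewrite addrC lerD // ?(nrmBC (u n)) ?tel' //.
by apply/ltW/hN; rewrite /= leq_addl.
Qed.

End NormTopology.

(** * Isometry of star-automorphisms, by square roots and unitaries *)

Section StarAutomorphisms.
Context {R : realType} {A : cstarType R}.
Implicit Types a b c : A.

Lemma mul_subC a b c d : a * b - c * d = (a - c) * b + c * (b - d).
Proof. by rewrite mulrBl mulrBr subrKA. Qed.

(* c = 1 - w for the fixed point w of the contraction w |-> (b^2 + w^2) / 2 *)
Lemma sqrt_one_minus_sqr b : star b = b -> nrm b < 1 ->
  exists c, [/\ star c = c, c * b = b * c & c * c = 1 - b * b].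
Proof.
move=> sb b1; set t := nrm b; have t0 : 0 <= t := nrm_ge0 b.
have t01 : 0 <= t < 1 by rewrite t0.
pose h : R := 2^-1; have h0 : `|h| = h by rewrite ger0_norm // invr_ge0.
pose w := fix w n : A :=
  if n is n'.+1 then h%:C%C *: (b * b + w n' * w n') else 0.
have wt n : nrm (w n) <= t.
  elim: n => [|n IH] /=; first by rewrite nrm0.
  rewrite nrm_scale h0; have := nrmD (b * b) (w n * w n).
  have := nrmM b b; have := nrmM (w n) (w n).
  have := ler_pM (nrm_ge0 _) (nrm_ge0 _) IH IH.
  have : t * t <= t by rewrite ler_piMr // ltW.
  by rewrite -/t /h; lra.
have sw n : star (w n) = w n.
  by elim: n => [|n IH] /=; rewrite ?star0 // star_scale starD !starM IH sb.
have wb n : w n * b = b * w n.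
  elim: n => [|n IH] /=; first by rewrite mul0r mulr0.
  rewrite -scalerAl -scalerAr mulrDl mulrDr !mulrA; congr (_ *: (_ + _)).
  by rewrite -[LHS]mulrA IH mulrA IH.
(* Squaring is 2 t-Lipschitz on the ball of radius t, which contains all [w n]; the factor 1/2 makes
   the iteration contract with ratio t = ||b|| < 1. *)
have lip a c : nrm a <= t -> nrm c <= t -> nrm (a * a - c * c) <= 2 * t * nrm (a - c).
  move=> at_ ct; rewrite mul_subC; apply: le_trans (nrmD _ _) _.
  apply: le_trans (lerD (nrmM _ _) (nrmM _ _)) _.
  have := ler_wpM2l (nrm_ge0 (a - c)) at_; have := ler_wpM2r (nrm_ge0 (a - c)) ct.
  by lra.
have step n : nrm (w n.+1 - w n) <= 1 * t ^+ n.
  elim: n => [|n IH]; first by rewrite expr0 mulr1 subr0; exact: le_trans (wt 1%N) (ltW b1).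
  rewrite mul1r in IH *.
  have -> : w n.+2 - w n.+1 = h%:C%C *: (w n.+1 * w n.+1 - w n * w n).
    by rewrite -scalerBr opprD addrACA subrr add0r.
  rewrite nrm_scale h0 exprS; have := lip _ _ (wt n.+1) (wt n).
  by have := ler_wpM2l t0 IH; rewrite /h; lra.
have [a ha] := nrm_geometric t01 step.
have small e : 0 < e -> \forall n \near \oo, nrm (w n - a) < e.
  move=> e0; near=> n; apply: le_lt_trans (ha n) _.
  by near: n; exact: geometric_small.
have at_ : nrm a <= t.
  apply/ler_addgt0Pl => e e0; have [n _ /(_ n (leqnn n)) an] := small e e0.
  by have := nrmB_abs a (w n); rewrite nrmBC ler_norml; have := wt n; rewrite /= in an; lra.
have sa : star a = a.
  apply/eqP; rewrite -subr_eq0; apply/eqP/nrm_small => e e0.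
  have [|n _ /(_ n (leqnn n)) an] := small (e / 2); first by rewrite divr_gt0.
  apply: le_trans (nrm_triangle (w n) _ _) _.
  rewrite -{1}(sw n) -starB nrm_star nrmBC; rewrite /= in an; lra.
have ab : a * b = b * a.
  apply/eqP; rewrite -subr_eq0; apply/eqP/nrm_small => e e0.
  have [|n _ /(_ n (leqnn n)) an] := small (e / 2); first by rewrite divr_gt0.
  apply: le_trans (nrm_triangle (w n * b) _ _) _.
  rewrite {2}wb -mulrBl -mulrBr.
  have := nrmM (a - w n) b; have := nrmM b (w n - a); rewrite (nrmBC a).
  have : nrm (w n - a) * nrm b <= nrm (w n - a) by rewrite ler_piMr ?nrm_ge0 // ltW.
  by rewrite /= in an; lra.
have aE : a = h%:C%C *: (b * b + a * a).
  apply/eqP; rewrite -subr_eq0; apply/eqP/nrm_small => e e0.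
  have e2 : 0 < e / 2 by rewrite divr_gt0.
  have : \forall n \near \oo, nrm (w n - a) < e / 2 /\ nrm (w n.+1 - a) < e / 2.
    near=> n; split; first by near: n; exact: small.
    near: n; have [N _ hN] := small _ e2.
    by exists N => // n Nn; apply: hN; exact: leqW.
  move=> [n _ /(_ n (leqnn n)) /= [an an1]].
  apply: le_trans (nrm_triangle (w n.+1) _ _) _.
  rewrite [X in nrm (w X - _)]/= -scalerBr opprD addrACA subrr add0r nrm_scale h0.
  have := lip _ _ (wt n) at_; rewrite (nrmBC a) /h.
  have : t * nrm (w n - a) <= nrm (w n - a) by rewrite ler_piMl ?nrm_ge0 // ltW.
  by move: an an1; rewrite /=; lra.
exists (1 - a); split.
- by rewrite starB star1 sa.
- by rewrite mulrBl mulrBr ab mul1r mulr1.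
(* The fixed point equation, read as 2 a = b^2 + a^2, turns (1 - a)^2 into 1 - b^2. *)
- have : (2%:R : R[i]) *: a = b * b + a * a.
    rewrite [X in _ *: X = _]aE scalerA /h fmorphV rmorph_nat.
    by rewrite mulfV ?pnatr_eq0 // scale1r.
  rewrite scaler_nat mulr2n => /eqP; rewrite -subr_eq => /eqP <-.
  by rewrite mulrBl mul1r mulrBr mulr1 -addrA -opprD addrA.
Unshelve. all: by end_near. Qed.

(** The element u = a + i c satisfies u^* u = 1, so it has norm 1, and a is the mean of u and
    u^*. *)
Lemma unitary_real_part a c : star a = a -> star c = c -> a * c = c * a ->
  a * a + c * c = 1 -> nrm a <= 1.
Proof.
move=> sa sc ac ac1; pose u := a + 'i *: c.
have su : star u = a - 'i *: c by rewrite starD starZ sa sc conjCi scaleNr.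
have uu : star u * u = 1.
  rewrite su mulrDr !mulrBl -!scalerAl -!scalerAr scalerA -(expr2 'i) sqrCi scaleN1r opprK.
  by rewrite ac addrA subrK.
have u1 : nrm u = 1.
  by apply/eqP; rewrite -(@eqrXn2 _ 2) ?nrm_ge0 // -nrm_starM uu nrm1 expr1n.
have -> : a = (2^-1 : R)%:C%C *: (u + star u).
  rewrite su addrACA subrr addr0 -mulr2n -(scaler_nat _ a) scalerA fmorphV rmorph_nat.
  by rewrite mulVf ?pnatr_eq0 // scale1r.
rewrite nrm_scale ger0_norm ?invr_ge0 //.
by have := nrmD u (star u); rewrite nrm_star u1; lra.
Qed.

(* For b self-adjoint with ||b|| < 1, phi b is the real part of the unitary
   phi b + i phi (sqrt (1 - b^2)). *)
Lemma star_automorphism_nrm_le (phi : A -> A) a :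
  star_automorphism phi -> nrm (phi a) <= nrm a.
Proof.
move=> aut.
have phiZ z b : phi (z *: b) = z *: phi b.
  have p0 : phi 0 = 0.
    have := saut_linear aut 1 0 0; rewrite !scale1r addr0 => h.
    by apply: (@addrI _ (phi 0)); rewrite -h addr0.
  by have := saut_linear aut z b 0; rewrite !addr0 p0 addr0.
have phiD b c : phi (b + c) = phi b + phi c.
  by have := saut_linear aut 1 b c; rewrite !scale1r.
have phi1 : phi 1 = 1.
  have [psi _ phiK] := saut_bij aut.
  by rewrite -[LHS]mulr1 -{2}(phiK 1) -(saut_mul aut) mul1r phiK.
have sa_lt1 b : star b = b -> nrm b < 1 -> nrm (phi b) <= 1.
  move=> sb b1; have [c [sc cb cc]] := sqrt_one_minus_sqr sb b1.
  apply: (@unitary_real_part _ (phi c)).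
  - by rewrite -(saut_star aut) sb.
  - by rewrite -(saut_star aut) sc.
  - by rewrite -!(saut_mul aut) cb.
  - by rewrite -!(saut_mul aut) -phiD cc addrC subrK.
(* Dividing by e + ||b|| with e > 0 brings the norm strictly below 1; then e tends to 0. *)
have sa_le b : star b = b -> nrm (phi b) <= nrm b.
  move=> sb; apply/ler_addgt0Pl => e e0.
  have t0 : 0 < e + nrm b by have := nrm_ge0 b; lra.
  pose t := (e + nrm b)^-1; have tp : 0 < t by rewrite invr_gt0.
  have := @sa_lt1 (t%:C%C *: b); rewrite star_scale sb phiZ !nrm_scale gtr0_norm //.
  rewrite ![t * _]mulrC ltr_pdivrMr // ler_pdivrMr // !mul1r; apply => //.
  by rewrite ltrDr.
(* For general [a] the squares are compared: by the C*-identity they are norms of self-adjoint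
   elements, and [phi] maps a^* a to the one on the left. *)
rewrite -(@ler_pXn2r _ 2) ?nnegrE ?nrm_ge0 // -!nrm_starM.
rewrite -(saut_star aut) -(saut_mul aut); apply: sa_le.
by rewrite starM starK.
Qed.

End StarAutomorphisms.

(** * Finite averages over orbits, and approximation by fixed elements *)

Section Averaging.
Context {R : realType} {A : cstarType R} {G : topologicalGroupType}.
Context (alpha : G -> A -> A) (alpha_action : is_action alpha).
Implicit Types (a b x : A) (g h k : G).

Lemma actZD g (z : R[i]) a b : alpha g (z *: a + b) = z *: alpha g a + alpha g b.
Proof. exact: saut_linear (action_aut alpha_action g) z a b. Qed.

Lemma actD g a b : alpha g (a + b) = alpha g a + alpha g b.
Proof. by have := actZD g 1 a b; rewrite !scale1r. Qed.

Lemma act0 g : alpha g 0 = 0.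
Proof. by apply: (@addrI _ (alpha g 0)); rewrite -actD !addr0. Qed.

Lemma actZ g (z : R[i]) a : alpha g (z *: a) = z *: alpha g a.
Proof. by have := actZD g z a 0; rewrite act0 !addr0. Qed.

Lemma actB g a b : alpha g (a - b) = alpha g a - alpha g b.
Proof. by rewrite actD -(scaleN1r b) actZ scaleN1r. Qed.

Lemma act_sum g (I : Type) (r : seq I) (P : pred I) (F : I -> A) :
  alpha g (\sum_(i <- r | P i) F i) = \sum_(i <- r | P i) alpha g (F i).
Proof. exact: (big_morph _ (actD g) (act0 g)). Qed.

Lemma actM g a b : alpha g (a * b) = alpha g a * alpha g b.
Proof. exact: saut_mul (action_aut alpha_action g) a b. Qed.

Lemma act_star g a : alpha g (star a) = star (alpha g a).
Proof. exact: saut_star (action_aut alpha_action g) a. Qed.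

Lemma act_id a : alpha 1%g a = a.
Proof.
have [psi K _] := saut_bij (action_aut alpha_action 1%g).
by rewrite -[LHS]K -(action_mul alpha_action) mul1g K.
Qed.

Lemma act_one g : alpha g 1 = 1.
Proof.
have [psi _ K] := saut_bij (action_aut alpha_action g).
by rewrite -[LHS]mulr1 -{2}(K 1) -actM mul1r K.
Qed.

(** The inequality for [g^-1] reverses the one for [g]. *)
Lemma nrm_act g a : nrm (alpha g a) = nrm a.
Proof.
apply/le_anti; rewrite (star_automorphism_nrm_le a (action_aut alpha_action g)) /=.
rewrite -{1}(act_id a) -(mulVg g) (action_mul alpha_action).
exact: star_automorphism_nrm_le (action_aut alpha_action _).
Qed.

Lemma nrm_actB g h k a : nrm (alpha (g * h)%g a - alpha (g * k)%g a) =
  nrm (alpha h a - alpha k a).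
Proof. by rewrite !(action_mul alpha_action) -actB nrm_act. Qed.

Context (G_compact : compact [set: G]).

Lemma compact_net (E : G -> set G) : (forall p, nbhs p (E p)) ->
  exists (n : nat) (p : 'I_n -> G), forall k, exists i, E (p i) k.
Proof.
(* The base point 1 turns [G] into a pointed space, to which [compact_cover] applies. *)
move=> Enbhs; pose pG : ptopologicalType := HB.pack G (isPointed.Build G 1%g).
have : @compact pG [set: pG] := G_compact; rewrite compact_cover.
case/(_ G [set: G] (fun p => (E p)^°)) => [p _|k _|D _ cov].
- exact: open_interior.
- by exists k => //; exact: Enbhs.
pose s : seq G := finmap.enum_fset D.
exists (size s), (fun i => tnth (in_tuple s) i) => k.
have [p /= Dp Epk] := cov k I.
have sp : (index p s < size s)%N by rewrite index_mem.
exists (Ordinal sp); rewrite (tnth_nth p) /= nth_index //.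
exact: interior_subset Epk.
Qed.

Lemma orbit_net (J : finType) (x : J -> A) (e : R) : 0 < e ->
  exists (n : nat) (p : 'I_n -> G),
    forall k, exists i, forall j, nrm (alpha (p i) (x j) - alpha k (x j)) < e.
Proof.
move=> e0.
apply: (@compact_net (fun p k => forall j, nrm (alpha p (x j) - alpha k (x j)) < e)) => p.
apply: filter_forall => j.
have := @continuous_nrm _ _ _ (fun k => alpha k (x j)) p e.
by apply => //; exact: action_continuous alpha_action (x j).
Qed.

(** The orbit of [b] is first approximated by finitely many points alpha (q j) b; a net chosen for
    these points then serves the whole orbit, because the action is isometric. Each of the three
    comparisons costs D / 3. *)
Lemma uniform_orbit_net b (D : R) : 0 < D ->
  exists (n : nat) (p : 'I_n -> G),
    forall k, exists i, forall h,
      nrm (alpha (p i) (alpha h b) - alpha k (alpha h b)) <= D.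
Proof.
move=> D0; have D3 : 0 < D / 3 by rewrite divr_gt0.
have [m [q hq]] := orbit_net (fun _ : 'I_1 => b) D3.
have [n [p hp]] := orbit_net (fun j : 'I_m => alpha (q j) b) D3.
exists n, p => k; have [i hi] := hp k; exists i => h.
have [j /(_ ord0) hj] := hq h.
apply: le_trans (nrm_triangle (alpha (p i) (alpha (q j) b)) _ _) _.
have := nrm_triangle (alpha k (alpha (q j) b)) (alpha (p i) (alpha (q j) b))
  (alpha k (alpha h b)).
rewrite -!actB !nrm_act (nrmBC (alpha h b)).
by have := hi j; move: hj; lra.
Qed.

Definition mean n (y : 'I_n -> A) : A := (n%:R^-1 : R)%:C%C *: \sum_i y i.

Lemma nrm_mean n (y : 'I_n -> A) :
  nrm (mean y) <= n%:R^-1 * \sum_i nrm (y i).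
Proof.
rewrite nrm_scale ger0_norm ?invr_ge0 //.
by apply: ler_wpM2l; rewrite ?invr_ge0 // nrm_sum.
Qed.

Lemma nrm_mean_le n (y : 'I_n -> A) (c : R) : (0 < n)%N ->
  (forall i, nrm (y i) <= c) -> nrm (mean y) <= c.
Proof.
move=> n0 yc; apply: le_trans (nrm_mean y) _.
rewrite ler_pdivrMl ?ltr0n //; apply: le_trans (ler_sum _ (fun i _ => yc i)) _.
by rewrite sumr_const card_ord mulr_natl.
Qed.

Lemma mean_const n a : (0 < n)%N -> mean (fun _ : 'I_n => a) = a.
Proof.
move=> n0; rewrite /mean sumr_const card_ord -(scaler_nat n a) scalerA.
by rewrite fmorphV rmorph_nat mulVf ?scale1r // pnatr_eq0 -lt0n.
Qed.

Lemma meanB n (y z : 'I_n -> A) : mean y - mean z = mean (fun i => y i - z i).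
Proof. by rewrite /mean -scalerBr -sumrB. Qed.

Lemma act_mean g n (y : 'I_n -> A) : alpha g (mean y) = mean (fun i => alpha g (y i)).
Proof. by rewrite /mean actZ act_sum. Qed.

Definition orbit_mean n (p : 'I_n -> G) x := mean (fun i => alpha (p i) x).

(* Averaging over a net (p i) maps an oscillation o to at most
   D / (2 n) + (1 - 1 / n) o, since any alpha g x is (D / 2)-close to some
   alpha (p i) x; the same net serves all iterated averages. *)
Lemma reduce_oscillation b (D0 D : R) : 0 < D ->
  (forall g, nrm (alpha g b - b) <= D0) ->
  exists2 x, nrm (x - b) <= D0 & forall g, nrm (alpha g x - x) <= D.
Proof.
move=> Dp oscb; have D2 : 0 < D / 2 by rewrite divr_gt0.
have [n [p hp]] := uniform_orbit_net b D2.
have n0 : (0 < n)%N by have [i _] := hp 1%g; exact: leq_ltn_trans (ltn_ord i).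
pose E := orbit_mean p; pose q : R := 1 - n%:R^-1.
(* The index i serves every h at once, so the estimate passes from orbit points of [b] to their
   averages. *)
have netE l : forall k, exists i, forall h,
    nrm (alpha (p i) (alpha h (iter l E b)) - alpha k (alpha h (iter l E b))) <= D / 2.
  move=> k; have [i hi] := hp k; exists i; elim: l => [//|l IH] h /=.
  rewrite /E /orbit_mean !act_mean meanB; apply: nrm_mean_le => // j.
  by rewrite -(action_mul alpha_action h).
have distE l h : nrm (alpha h (iter l E b) - b) <= D0.
  elim: l h => [//|l IH] h /=.
  rewrite /E /orbit_mean act_mean -{2}(mean_const b n0) meanB.
  by apply: nrm_mean_le => // j; rewrite -(action_mul alpha_action h).
(* D / 2 is the fixed point of o |-> D / (2 n) + (1 - 1 / n) o, so the excess over D / 2 shrinks by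
   the factor q at every step. *)
have oscE l g : nrm (alpha g (iter l E b) - iter l E b) <= D / 2 + D0 * q ^+ l.
  elim: l g => [|l IH] g; first by rewrite expr0 mulr1; apply: le_trans (oscb g) _; lra.
  rewrite iterS; set x := iter l E b in IH *.
  rewrite {1}/E /orbit_mean act_mean -(mean_const (E x) n0) meanB.
  apply: nrm_mean_le => // i; rewrite -(action_mul alpha_action g).
  rewrite -(mean_const (alpha _ x) n0) meanB; apply: le_trans (nrm_mean _) _.
  have [j hj] := netE l (g * p i)%g.
  rewrite (bigD1 j) //=.
  have := hj 1%g; rewrite !act_id nrmBC -/x => {}hj.
  have : \sum_(i0 < n | i0 != j) nrm (alpha (g * p i)%g x - alpha (p i0) x)
      <= (n%:R - 1) * (D / 2 + D0 * q ^+ l).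
    apply: (@le_trans _ _ (\sum_(i0 < n | i0 != j) (D / 2 + D0 * q ^+ l))).
      apply: ler_sum => i0 _.
      have := IH ((p i0)^-1 * (g * p i))%g; rewrite -[X in nrm (_ - X)]act_id.
      by rewrite -(mulVg (p i0)) nrm_actB.
    rewrite sumr_const; set c := #|_|.
    have -> : c = n.-1 by rewrite /c cardC1 card_ord.
    by rewrite -[leLHS]mulr_natl -subn1 natrB.
  rewrite ler_pdivrMl ?ltr0n // => hs; apply: le_trans (lerD hj hs) _.
  have -> : D0 * q ^+ l.+1 = q * (D0 * q ^+ l) by rewrite exprS; ring.
  have nq : n%:R * q = n%:R - 1 by rewrite /q mulrBr mulr1 mulfV // pnatr_eq0 -lt0n.
  have -> : n%:R * (D / 2 + q * (D0 * q ^+ l)) = n%:R * (D / 2) + n%:R * q * (D0 * q ^+ l).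
    by ring.
  by rewrite nq le_eqVlt; apply/orP; left; apply/eqP; ring.
have q01 : 0 <= q < 1.
  rewrite subr_ge0 invf_le1 ?ltr0n // ler1n n0 /=.
  by rewrite ltrBlDr ltrDl invr_gt0 ltr0n.
have [l _ /(_ l (leqnn l)) small] := geometric_small D0 q01 D2.
exists (iter l E b); first by have := distE l 1%g; rewrite act_id.
by move=> g; apply: le_trans (oscE l g) _; rewrite /= in small; lra.
Qed.

(** Each use of [reduce_oscillation] halves the oscillation and moves the element by at most the old
    one. The displacements D / 2^n sum to 2 D, and the limit has oscillation zero. *)
Lemma fixed_point_near b (D : R) : 0 < D ->
  (forall g, nrm (alpha g b - b) <= D) ->
  exists2 c, fixed_algebra alpha c & nrm (b - c) <= 2 * D.
Proof.
move=> D0 oscb.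
pose osc x (c : R) := forall g, nrm (alpha g x - x) <= c.
(* The oscillation bound is a premise inside the relation, so that [choice] yields a total function;
   where it fails the value is a dummy 0. *)
have /choice[f hf] : forall xn : A * nat, exists y, osc xn.1 (D * 2^-1 ^+ xn.2) ->
    nrm (y - xn.1) <= D * 2^-1 ^+ xn.2 /\ osc y (D * 2^-1 ^+ xn.2.+1).
  move=> [x n] /=; have [ox|nox] := pselect (osc x (D * 2^-1 ^+ n)); last by exists 0.
  have [|y yx oy] := @reduce_oscillation x (D * 2^-1 ^+ n) (D * 2^-1 ^+ n.+1) _ ox.
    by rewrite mulr_gt0 // exprn_gt0 // invr_gt0.
  by exists y.
pose u := fix u n := if n is m.+1 then f (u m, m) else b.
have ou n : osc (u n) (D * 2^-1 ^+ n).
  elim: n => [|n IH]; first by rewrite expr0 mulr1.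
  exact: (hf (u n, n) IH).2.
have q01 : 0 <= (2^-1 : R) < 1 by lra.
have [|c hc] := @nrm_geometric _ _ u D _ q01.
  by move=> n; exact: (hf (u n, n) (ou n)).1.
exists c; last first.
  have -> : 2 * D = D / (1 - 2^-1) * 2^-1 ^+ 0 by rewrite expr0; field.
  exact: hc 0%N.
move=> g; apply/eqP; rewrite -subr_eq0; apply/eqP/nrm_small => e e0.
(* The factor 5 is 2 + 1 + 2: twice the distance from [u n] to [c], and once the oscillation of
   [u n], in units of D / 2^n. *)
have [n _ /(_ n (leqnn n)) small] := geometric_small (5 * D) q01 e0.
apply: le_trans (nrm_triangle (alpha g (u n)) _ _) _.
rewrite -actB nrm_act; have := nrm_triangle (u n) (alpha g (u n)) c.
have := ou n g; have := hc n; rewrite (nrmBC c) /= in small *.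
have : D / (1 - 2^-1) * 2^-1 ^+ n = 2 * (D * 2^-1 ^+ n) by field.
by move=> ->; lra.
Qed.

End Averaging.

(** * Cutdowns by functional calculus, and Cuntz subequivalence inside an ideal *)

Section Cutdowns.
Context {R : realType} {A : cstarType R}.
Implicit Types (a b c d : A) (z w : R[i]).

Lemma lipschitz_continuous (f : R[i]^o -> R[i]^o) :
  (forall z w, `|f z - f w| <= `|z - w|) -> continuous f.
Proof.
move=> lip z; pose V : normedModType R[i] := R[i]^o.
apply/(@cvgrPdist_lt R[i] V V (nbhs z) (@nbhs_filter V z) f (f z)) => e e0.
apply/(@nbhs_ballP R[i] V); exists e => //= w zw.
exact: le_lt_trans (lip z w) zw.
Qed.

Lemma lipschitz_conj z w : `|z^* - w^*| <= `|z - w|.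
Proof. by rewrite -rmorphB norm_conjC. Qed.

Lemma lipschitz_cutoff (e : R) z w :
  `|(Num.max 0 (complex.Re z - e))%:C%C - (Num.max 0 (complex.Re w - e))%:C%C|
    <= `|z - w|.
Proof.
rewrite -rmorphB /= !normc_def /= expr0n addr0 sqrtr_sqr lecR.
have -> : complex.Re (z - w) = complex.Re z - complex.Re w by case: z w => [? ?] [? ?].
set x := complex.Re z; set y := complex.Re w; set v := _ ^+ 2.
apply: (@le_trans _ _ `|x - y|); last first.
  by rewrite -sqrtr_sqr ler_sqrt ?addr_ge0 ?sqr_ge0 // lerDl sqr_ge0.
rewrite !maxEle; case: ifP => h1; case: ifP => h2; rewrite ler_norml;
  by case: (ler0P (x - y)) => h3; lra.
Qed.

(** The calculus is isometric, and on a spectrum contained in the nonnegative reals z - max(0, z -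
    e) = min(z, e). That the spectrum of 1 - d lies there is also read off from the isometry. *)
Lemma nrm_cutdown d c (e : R) : star d = d -> nrm d <= 1 -> 0 < e ->
  is_cutdown (1 - d) e c -> nrm (1 - d - c) <= e.
Proof.
move=> sd d1 e0 [Phi calc ->]; set a := 1 - d in calc *.
have within (f : R[i]^o -> R[i]^o) : continuous f -> {within spectrum a, continuous f}.
  by move=> cf; exact: (@continuous_subspaceT _ _ (spectrum a) f cf).
have cid : {within spectrum a, continuous (id : R[i]^o -> R[i]^o)}.
  by apply: within => z; exact: cvg_id.
have diff (f g : R[i]^o -> R[i]^o) :
    {within spectrum a, continuous f} -> {within spectrum a, continuous g} ->
    {within spectrum a, continuous (fun z => f z + -1 * g z : R[i]^o)} /\
    Phi (fun z => f z + -1 * g z) = Phi f - Phi g.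
  move=> cf cg.
  have cg' : {within spectrum a, continuous (fun z => -1 * g z : R[i]^o)}.
    by move=> z; apply: cvgM; [exact: cvg_cst | exact: cg].
  split; first by move=> z; apply: cvgD; [exact: cf | exact: cg'].
  by rewrite (calcD calc) // (calcZ calc) // scaleN1r.
have bound (f : R[i]^o -> R[i]^o) z : {within spectrum a, continuous f} -> spectrum a z ->
    complex.Re `|f z| <= nrm (Phi f).
  move=> cf sz; rewrite -lee_fin (calc_norm calc cf).
  by apply: ereal_sup_ubound; exists z.
(* The function z - conj z has image a - a^* = 0, so it vanishes on the spectrum. *)
have real z : spectrum a z -> complex.Im z = 0.
  move=> sz; have cc := within _ (lipschitz_continuous lipschitz_conj).
  have [cd dE] := diff _ _ cid cc.
  have := bound _ _ cd sz; rewrite dE (calc_star calc cid) (calc_id calc).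
  rewrite starB star1 sd subrr nrm0 mulN1r => h.
  have : z - z^* = 0.
    apply/normr0_eq0; rewrite normc_def; congr (_%:C%C); apply/le_anti.
    by move: h; rewrite normc_def /= => ->; rewrite sqrtr_ge0.
  by case: z {sz h} => x y [_] /=; rewrite opprK => /eqP; rewrite -mulr2n mulrn_eq0 => /eqP.
(* The function 1 - z has image d, so |1 - z| <= ||d|| <= 1 on the spectrum. *)
have nonneg z : spectrum a z -> 0 <= complex.Re z.
  move=> sz; have c1 : {within spectrum a, continuous (fun=> 1 : R[i]^o)}.
    exact: within (@cst_continuous _ _ _).
  have [cd dE] := diff _ _ c1 cid.
  have := bound _ _ cd sz; rewrite dE (calc_1 calc) (calc_id calc) /a opprB addrCA subrr addr0.
  move=> /le_trans/(_ d1); rewrite mulN1r normc_def /=.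
  case: z sz => x y sz /=; have /= -> := real _ sz.
  rewrite subrr expr0n addr0 sqrtr_sqr ler_norml; lra.
have ccut := within _ (lipschitz_continuous (lipschitz_cutoff e)).
have [cd dE] := diff _ _ cid ccut.
rewrite -{1}(calc_id calc) -dE -lee_fin (calc_norm calc cd).
apply: ub_ereal_sup => _ [z sz <-]; rewrite lee_fin mulN1r normc_def.
have z0 := nonneg z sz; have /= := real z sz; case: z z0 {sz} => x y /= x0 ->.
rewrite subr0 expr0n addr0 sqrtr_sqr maxEle.
by case: ifP => h; rewrite ler_norml; lra.
Qed.

Lemma nrm_le_stab_norm (T : nat -> nat -> A) :
  ((nrm (T 0%N 0%N))%:E <= stab_norm T)%E.
Proof.
apply: ereal_sup_ubound; exists 1%N, (\col_i 1), (\col_i 1).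
have E : (adjmx (\col_(i < 1) (1 : A)) *m \col_(i < 1) 1) ord0 ord0 = 1.
  by rewrite mxE big_ord1 !mxE star1 mulr1.
split; rewrite ?E ?nrm1 //; congr (_%:E); congr nrm.
by rewrite mxE big_ord1 !mxE big_ord1 !mxE star1 mulr1 mul1r.
Qed.

(** Norm limits are unique, so the limit picked by [xget] is forced. *)
Lemma xget_cvg (u : nat -> A) a : (\forall n \near \oo, u n = a) ->
  xget 0 [set l | u @ \oo --> l] = a.
Proof.
move=> ua; have cv : u @ \oo --> a.
  move=> U /nbhs_singleton Ua; rewrite /= /nbhs /=.
  by apply: filterS ua => n /= ->.
apply: xget_unique => // b ub; apply/eqP; rewrite -subr_eq0; apply/eqP/nrm_small => e e0.
have : \forall n \near \oo, nrm (b - u n) < e.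
  by apply: (ub [set x | nrm (b - x) < e]); apply/nbhs_nrm; exists e.
move=> ub'; have [n _ /(_ n (leqnn n)) [/= un bu]] := filterI ua ub'.
by rewrite -un ltW.
Qed.

(** Only the summand k = 0 meets the corner, so the partial sums are constant from n = 1 on. *)
Lemma stab_mul_corner00 (r T : nat -> nat -> A) b :
  stab_mul (stab_mul (stab_star r) (stab_corner b)) r 0%N 0%N
  = star (r 0%N 0%N) * b * r 0%N 0%N.
Proof.
have E j : stab_mul (stab_star r) (stab_corner b) 0%N j
    = if j == 0%N then star (r 0%N 0%N) * b else 0.
  apply: xget_cvg; exists 1%N => // -[//|n] _.
  rewrite /= big_ord_recl big1 ?addr0 => [|k _]; rewrite /stab_corner /=.
    by case: (j == 0%N); rewrite ?mulr0.
  by rewrite mulr0.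
apply: xget_cvg; exists 1%N => // -[//|n] _.
rewrite /= big_ord_recl big1 ?addr0 ?E // => k _.
by rewrite E mul0r.
Qed.

(** The (0,0) entry of r^* y r is r00^* y r00, which lies in [I]. The norm of an entry is at most
    the stable norm, so [c] is a limit of such elements. *)
Lemma cuntz_sub_ideal (B I : set A) c y : (forall b, B b -> B (star b)) ->
  closed_ideal B I -> I y -> cuntz_sub B (stab_corner c) (stab_corner y) -> I c.
Proof.
move=> Bstar [_ Iclosed _ _ Imul] Iy [r rB rlim].
have /closed_nrm := Iclosed; apply => e e0.
have e0' : (0 < e%:E)%E by rewrite lte_fin.
have := rlim _ (open_ereal_lt' e0').
move=> [n _ /(_ n (leqnn n)) /= rn].
have rBn : B (r n 0%N 0%N) by have [] := rB n.
exists (star (r n 0%N 0%N) * y * r n 0%N 0%N).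
  apply: (Imul _ _ rBn _).2; exact: (Imul _ _ (Bstar _ rBn) Iy).1.
rewrite nrmBC -lte_fin; apply: le_lt_trans rn.
by have := nrm_le_stab_norm (fun i j => stab_mul (stab_mul (stab_star (r n))
  (stab_corner y)) (r n) i j - stab_corner c i j); rewrite stab_mul_corner00.
Qed.

End Cutdowns.

(** * Sequences in the algebra up to errors tending to 0 *)

Section AsymptoticEquality.
Context {R : realType} {A : cstarType R}.
Implicit Types u v w : nat -> A.

Definition asymptotic u v :=
  forall e : R, 0 < e -> \forall n \near \oo, nrm (u n - v n) < e.

Definition bounded_seq u := exists C : R, forall n, nrm (u n) <= C.

Definition limsup_le u (c : R) :=
  forall e : R, 0 < e -> \forall n \near \oo, nrm (u n) < c + e.

Lemma asymptotic_refl u : asymptotic u u.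
Proof. by move=> e e0; near=> n; rewrite subrr nrm0. Unshelve. all: by end_near. Qed.

Lemma asymptotic_sym u v : asymptotic u v -> asymptotic v u.
Proof. by move=> uv e e0; apply: filterS (uv e e0) => n; rewrite nrmBC. Qed.

Lemma asymptotic_trans v u w : asymptotic u v -> asymptotic v w -> asymptotic u w.
Proof.
move=> uv vw e e0; have e2 : 0 < e / 2 by rewrite divr_gt0.
apply: filterS2 (uv _ e2) (vw _ e2) => n h1 h2.
by have := nrm_triangle (v n) (u n) (w n); lra.
Qed.

Lemma asymptoticD u u' v v' : asymptotic u u' -> asymptotic v v' ->
  asymptotic (fun n => u n + v n) (fun n => u' n + v' n).
Proof.
move=> uu vv e e0; have e2 : 0 < e / 2 by rewrite divr_gt0.
apply: filterS2 (uu _ e2) (vv _ e2) => n h1 h2.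
rewrite opprD addrACA; have := nrmD (u n - u' n) (v n - v' n); lra.
Qed.

Lemma asymptotic_sum (I : Type) (r : seq I) (F H : I -> nat -> A) :
  (forall i, asymptotic (F i) (H i)) ->
  asymptotic (fun n => \sum_(i <- r) F i n) (fun n => \sum_(i <- r) H i n).
Proof.
move=> FH; elim: r => [|i r IH] e e0.
  by near=> n; rewrite !big_nil subrr nrm0.
apply: filterS (asymptoticD (FH i) IH e0) => n.
by rewrite !big_cons.
Unshelve. all: by end_near. Qed.

Lemma asymptoticM u u' v v' : bounded_seq u' -> bounded_seq v ->
  asymptotic u u' -> asymptotic v v' ->
  asymptotic (fun n => u n * v n) (fun n => u' n * v' n).
Proof.
move=> [C hC] [D hD] uu vv e e0.
have C0 : 0 <= C := le_trans (nrm_ge0 _) (hC 0%N).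
have D0 : 0 <= D := le_trans (nrm_ge0 _) (hD 0%N).
pose M := 2 * (C + D + 1); have M0 : 0 < M by rewrite /M; lra.
apply: filterS2 (uu _ (divr_gt0 e0 M0)) (vv _ (divr_gt0 e0 M0)) => n h1 h2.
rewrite mul_subC; apply: le_lt_trans (nrmD _ _) _.
apply: le_lt_trans (lerD (nrmM _ _) (nrmM _ _)) _.
have := ler_pM (nrm_ge0 _) (nrm_ge0 _) (ltW h1) (hD n).
have := ler_pM (nrm_ge0 _) (nrm_ge0 _) (hC n) (ltW h2).
have : e = e / M * (2 * (C + D + 1)) by rewrite -/M mulfVK // gt_eqF.
have : 0 < e / M by rewrite divr_gt0.
set t := e / M => t0; nra.
Qed.

Lemma bounded_cst (a : A) : bounded_seq (fun=> a).
Proof. by exists (nrm a). Qed.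

Lemma boundedM u v : bounded_seq u -> bounded_seq v -> bounded_seq (fun n => u n * v n).
Proof.
move=> [C hC] [D hD]; exists (C * D) => n; apply: le_trans (nrmM _ _) _.
by apply: ler_pM => //; exact: nrm_ge0.
Qed.

Lemma bounded_sum (I : Type) (r : seq I) (F : I -> nat -> A) :
  (forall i, bounded_seq (F i)) -> bounded_seq (fun n => \sum_(i <- r) F i n).
Proof.
move=> hF; elim: r => [|i r [D hD]]; first by exists 0 => n; rewrite big_nil nrm0.
have [C hC] := hF i; exists (C + D) => n; rewrite big_cons.
exact: le_trans (nrmD _ _) (lerD (hC n) (hD n)).
Qed.

Lemma limsup_le_asymptotic u v (c : R) : asymptotic u v -> limsup_le v c -> limsup_le u c.
Proof.
move=> uv vc e e0; have e2 : 0 < e / 2 by rewrite divr_gt0.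
apply: filterS2 (uv _ e2) (vc _ e2) => n h1 h2.
by have := nrmD (u n - v n) (v n); rewrite subrK; lra.
Qed.

Lemma limsup_le_contractM u v (c : R) : (forall n, nrm (u n) <= 1) ->
  limsup_le v c -> limsup_le (fun n => u n * v n) c.
Proof.
move=> u1 vc e e0; apply: filterS (vc e e0) => n h.
apply: le_lt_trans (nrmM _ _) _; apply: le_lt_trans h.
by rewrite ler_piMl // nrm_ge0.
Qed.

(** The C*-identity, together with c^2 + e^2 <= (c + e)^2. *)
Lemma limsup_le_sqr u (c : R) : 0 <= c ->
  limsup_le (fun n => star (u n) * u n) (c ^+ 2) -> limsup_le u c.
Proof.
move=> c0 h e e0; have e2 : 0 < e ^+ 2 by rewrite exprn_gt0.
apply: filterS (h _ e2) => n; rewrite nrm_starM => h1.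
have ce : 0 <= c + e by lra.
rewrite -(@ltr_pXn2r _ 2) ?nnegrE ?nrm_ge0 //; apply: lt_le_trans h1 _.
by have := mulr_ge0 c0 (ltW e0); rewrite sqrrD; lra.
Qed.

End AsymptoticEquality.

(** * Functions on the group, and their products along words *)

Section EvaluationCG.
Context {R : realType} {G : topologicalGroupType}.
Implicit Types f h : CG R G.

Lemma CG_cstE (z : R[i]) (g : G) : CG_cst z g = z.
Proof. by []. Qed.

Lemma CG_addE f h g : CG_add f h g = f g + h g.
Proof. by []. Qed.

Lemma CG_mulE f h g : CG_mul f h g = f g * h g.
Proof. by []. Qed.

Lemma LtE k f g : Lt k f g = f (k^-1 * g)%g.
Proof. by []. Qed.

End EvaluationCG.

Section Monomials.
Context {R : realType} {G : topologicalGroupType} (L : Type) (chi : L -> CG R G).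

(** Words are used in place of exponents: concatenation is multiplication, and the word length is
    what the counting argument measures. *)
Definition monomial (s : seq L) : CG R G :=
  foldr (fun l f => CG_mul (chi l) f) (CG_cst 1) s.

Lemma monomialE s g : monomial s g = \prod_(l <- s) chi l g.
Proof. by elim: s => [|l s IH]; rewrite ?big_nil // big_cons -IH. Qed.

Lemma monomial_cat s t : monomial (s ++ t) = CG_mul (monomial s) (monomial t).
Proof. by apply/continuousEP => g; rewrite monomialE big_cat -!monomialE. Qed.

End Monomials.

(** * Contractive completely positive maps on C(G) *)

Section CompletelyPositiveMaps.
Context {R : realType} {A : cstarType R} {G : topologicalGroupType}.
Context (D : set A) (psi : CG R G -> A) (psi_ccp : contractive_cp_map D psi).
Implicit Types f h : CG R G.

Lemma ccp_nrm_le f (c : R) : (forall g, `|f g| <= c%:C%C) -> nrm (psi f) <= c.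
Proof.
move=> fc; rewrite -lee_fin; apply: le_trans (ccp_contractive psi_ccp f) _.
apply: ub_ereal_sup => _ [g _ <-]; rewrite lee_fin.
by have := fc g; rewrite lecE => /andP[].
Qed.

Lemma ccp_nrmB_le f h (c : R) : (forall g, `|f g - h g| <= c%:C%C) ->
  nrm (psi f - psi h) <= c.
Proof.
move=> fhc; rewrite -scaleN1r -(ccpZ psi_ccp) -(ccpD psi_ccp); apply: ccp_nrm_le => g.
by rewrite CG_addE CG_mulE CG_cstE mulN1r.
Qed.

Lemma ccp_sum (I : Type) (r : seq I) (F : I -> CG R G) :
  psi (\big[CG_add/CG_cst 0]_(i <- r) F i) = \sum_(i <- r) psi (F i).
Proof.
apply: (big_morph _ (ccpD psi_ccp)).
have -> : CG_cst 0 = CG_mul (CG_cst 0) (CG_cst 0) :> CG R G.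
  by apply/continuousEP => g; rewrite CG_mulE mul0r.
by rewrite (ccpZ psi_ccp) scale0r.
Qed.

(** A real f equals ((f + 1) / 2)^2 - ((f - 1) / 2)^2, and positivity on 1 x 1 matrices makes the
    image of each square self-adjoint. *)
Lemma ccp_star_real f : (forall g, (f g)^* = f g) -> star (psi f) = psi f.
Proof.
move=> freal.
pose half z : CG R G := CG_mul (CG_cst 2^-1) (CG_add f (CG_cst z)).
have sq z : z^* = z -> star (psi (CG_mul (half z) (half z))) = psi (CG_mul (half z) (half z)).
  move=> zr; have [|X _ /matrixP/(_ ord0 ord0)] :=
    @ccp_positive _ _ _ _ _ psi_ccp 1 (const_mx (CG_mul (half z) (half z))).
    exists (const_mx (half z)) => i j g; rewrite big_ord1 !mxE !CG_mulE !CG_addE !CG_cstE.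
    by rewrite rmorphM rmorphD /= freal zr fmorphV rmorph_nat.
  by rewrite !mxE big_ord1 !mxE => ->; rewrite starM starK.
have -> : f = CG_add (CG_mul (half 1) (half 1))
                (CG_mul (CG_cst (-1)) (CG_mul (half (-1)) (half (-1)))).
  by apply/continuousEP => g; rewrite !(CG_addE, CG_mulE, CG_cstE); field.
rewrite (ccpD psi_ccp) (ccpZ psi_ccp) starD starZ !sq ?rmorphN1 ?rmorph1 //.
Qed.

End CompletelyPositiveMaps.

(** The left side counts the possible letter counts of words of length at most 2^q N in c letters.
    It is at most 2^(c (q + N)), and the exponent c (q + N) is eventually below 2^q. *)
Lemma types_vs_double_exponential (N c : nat) :
  exists q, ((2 ^ q * N).+1 ^ c <= 2 ^ (2 ^ q))%N.
Proof.
(* The shift by 4 is forced: n^2 <= 2^n fails at n = 3. *)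
have sqr_le q : ((q + 4) ^ 2 <= 2 ^ (q + 4))%N.
  elim: q => [//|q IH]; rewrite addSn [leqRHS]expnS.
  apply: leq_trans (leq_mul (leqnn 2) IH).
  by rewrite !expnS expn0; nia.
pose q := (2 * (c + N) + 4)%N; exists q.
have h : ((2 ^ q * N).+1 <= 2 ^ (q + N))%N.
  apply: (@leq_trans (2 ^ q * N.+1)); first by rewrite mulnS -add1n leq_add2r expn_gt0.
  by rewrite expnD leq_mul2l ltn_expl // orbT.
apply: (@leq_trans ((2 ^ (q + N)) ^ c)).
  by case: (posnP c) => [->|c0]; rewrite ?expn0 // leq_exp2r.
rewrite -expnM leq_exp2l //; apply: leq_trans (sqr_le (2 * (c + N))%N).
by rewrite /q !expnS expn0; nia.
Qed.

(** * Norm bounds for sums of terms psi(monomial) x *)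

Section KeyBound.
Context {R : realType} {A : cstarType R} {G : topologicalGroupType}.
Context (D : nat -> set A) (psi : nat -> CG R G -> A).
Context (psi_ccp : forall n, contractive_cp_map (D n) (psi n)).
Context (L : finType) (chi : L -> CG R G) (chi01 : forall l g, 0 <= chi l g <= 1).
Local Notation mon := (monomial chi).
Context (psi_mul : forall s t, asymptotic
  (fun n => psi n (CG_cst 1) * psi n (CG_mul (mon s) (mon t)))
  (fun n => psi n (mon s) * psi n (mon t))).
Context (psi_comm : forall s a, asymptotic
  (fun n => psi n (mon s) * a) (fun n => a * psi n (mon s))).

Lemma monomial_ge0 s g : 0 <= mon s g.
Proof. by rewrite monomialE prodr_ge0 // => l _; case/andP: (chi01 l g). Qed.

Lemma monomial_le1 s g : mon s g <= 1.
Proof. by rewrite monomialE prodr_ile1. Qed.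

Lemma star_psi_monomial n s : star (psi n (mon s)) = psi n (mon s).
Proof.
apply: ccp_star_real (psi_ccp n) _ _ => g.
by rewrite conj_Creal // ger0_real // monomial_ge0.
Qed.

Lemma nrm_psi_monomial n s : nrm (psi n (mon s)) <= 1.
Proof.
apply: (@ccp_nrm_le R A G _ _ (psi_ccp n)) => g.
by rewrite ger0_norm ?monomial_ge0 ?monomial_le1.
Qed.

Lemma bounded_psi s : bounded_seq (fun n => psi n (mon s)).
Proof. by exists 1 => n; exact: nrm_psi_monomial. Qed.

(* the value at n of psi_n (x) id_A on sum_i mon (s i) (x) x i *)
Definition psi_sum (I : finType) (s : I -> seq L) (x : I -> A) (n : nat) : A :=
  \sum_i psi n (mon (s i)) * x i.

(* Words with the same letter counts give the same monomial, so their terms can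
   be grouped, and each group of k words satisfies k mon <= 1. *)
Lemma psi_sum_le_types (I : finType) (s : I -> seq L) (x : I -> A)
    (N : nat) (delta : R) (n : nat) :
  0 <= delta -> (forall g, \sum_i mon (s i) g <= 1) ->
  (forall i, nrm (x i) <= delta) -> (forall i, (size (s i) <= N)%N) ->
  nrm (psi_sum s x n) <= (N.+1 ^ #|L|)%:R * delta.
Proof.
move=> delta0 sum_le1 xdelta sN.
(* Counts are at most [size (s i)], hence at most N, so [inord] loses no information. *)
pose type i := [ffun l => inord (count_mem l (s i)) : 'I_N.+1].
have type_mon i j : type i = type j -> mon (s i) = mon (s j).
  move=> /ffunP tij; apply/continuousEP => g; rewrite !monomialE; apply: perm_big.
  apply/allP => l _ /=; have := congr1 (@nat_of_ord _) (tij l); rewrite !ffunE !inordK ?ltnS.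
  - by move=> ->.
  - exact: leq_trans (count_size _ _) (sN j).
  - exact: leq_trans (count_size _ _) (sN i).
rewrite /psi_sum (partition_big type predT) //=; apply: le_trans (nrm_sum _ _ _) _.
have -> : (N.+1 ^ #|L|)%:R * delta = \sum_(t : {ffun L -> 'I_N.+1}) delta.
  by rewrite sumr_const card_ffun card_ord mulr_natl.
apply: ler_sum => t _.
have [i0 /eqP ti0|no] := pickP (fun i => type i == t); last first.
  by rewrite big_pred0 // nrm0.
rewrite (eq_bigr (fun i => psi n (mon (s i0)) * x i)); last first.
  by move=> i /eqP ti; rewrite (@type_mon i i0) // ti.
rewrite -mulr_sumr; apply: le_trans (nrmM _ _) _.
set k := #|[pred i | type i == t]|.
have xk : nrm (\sum_(i | type i == t) x i) <= k%:R * delta.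
  apply: le_trans (nrm_sum _ _ _) _; apply: le_trans (ler_sum _ (fun i _ => xdelta i)) _.
  by rewrite sumr_const mulr_natl.
apply: le_trans (ler_wpM2l (nrm_ge0 _) xk) _; rewrite mulrA ler_piMl //.
have -> : nrm (psi n (mon (s i0))) * k%:R = nrm (psi n (CG_mul (CG_cst k%:R) (mon (s i0)))).
  rewrite (ccpZ (psi_ccp n)) -(rmorph_nat (real_complex R)) nrm_scale.
  by rewrite ger0_norm ?ler0n // mulrC.
apply: (@ccp_nrm_le R A G _ _ (psi_ccp n)) => g; rewrite CG_mulE CG_cstE.
rewrite ger0_norm ?mulr_ge0 ?ler0n ?monomial_ge0 //; apply: le_trans (sum_le1 g).
rewrite [leRHS](bigID (fun i => type i == t)) /=.
rewrite (eq_bigr (fun=> mon (s i0) g)); last first.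
  by move=> i /eqP ti; rewrite (@type_mon i i0) // ti.
by rewrite sumr_const mulr_natl lerDl sumr_ge0 // => i _; exact: monomial_ge0.
Qed.

Lemma psi_sum_star (I : finType) (s : I -> seq L) (x : I -> A) :
  asymptotic (fun n => star (psi_sum s x n)) (psi_sum s (star \o x)).
Proof.
apply: (asymptotic_trans (v := fun n => \sum_i star (x i) * psi n (mon (s i)))).
  move=> e e0; near=> n; rewrite /psi_sum star_sum.
  by under eq_bigr do rewrite starM star_psi_monomial; rewrite subrr nrm0.
by apply: asymptotic_sum => i; exact/asymptotic_sym/psi_comm.
Unshelve. all: by end_near. Qed.

Lemma bounded_psi_sum (I : finType) (s : I -> seq L) (x : I -> A) :
  bounded_seq (psi_sum s x).
Proof.
apply: bounded_sum => i; apply: boundedM (bounded_cst _); exact: bounded_psi.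
Qed.

(** First x i is moved past psi(mon (t k)), then psi(f) psi(h) is replaced by psi(1) psi(f h). The
    factor psi(1) remains because [psi] is multiplicative only in this weak sense. *)
Lemma psi_sum_mul (I K : finType) (s : I -> seq L) (t : K -> seq L)
    (x : I -> A) (z : K -> A) : asymptotic
  (fun n => psi_sum s x n * psi_sum t z n)
  (fun n => psi n (CG_cst 1) *
     psi_sum (fun ik : I * K => s ik.1 ++ t ik.2) (fun ik => x ik.1 * z ik.2) n).
Proof.
apply: (asymptotic_trans (v := fun n => \sum_(ik : I * K)
    psi n (mon (s ik.1)) * (x ik.1 * psi n (mon (t ik.2))) * z ik.2)).
  move=> e e0; near=> n; rewrite /psi_sum mulr_suml.
  under eq_bigr do rewrite mulr_sumr; rewrite pair_big /=.
  by under eq_bigr do rewrite !mulrA; under [X in _ - X]eq_bigr do rewrite !mulrA;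
    rewrite subrr nrm0.
apply: (asymptotic_trans (v := fun n => \sum_(ik : I * K)
    psi n (CG_cst 1) * psi n (mon (s ik.1 ++ t ik.2)) * (x ik.1 * z ik.2))).
  apply: asymptotic_sum => -[i k] /=.
  apply: (asymptotic_trans
    (v := fun n => psi n (mon (s i)) * (psi n (mon (t k)) * x i) * z k)).
    apply: asymptoticM (asymptotic_refl _); last apply: asymptoticM (asymptotic_refl _) _.
    - by do !apply: boundedM; do ?exact: bounded_psi; exact: bounded_cst.
    - exact: bounded_cst.
    - exact: bounded_psi.
    - by apply: boundedM; [exact: bounded_cst | exact: bounded_psi].
    - exact/asymptotic_sym/psi_comm.
  apply: (asymptotic_trans
    (v := fun n => psi n (mon (s i)) * psi n (mon (t k)) * (x i * z k))).
    by move=> e e0; near=> n; rewrite !mulrA subrr nrm0.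
  rewrite monomial_cat; apply: asymptoticM (asymptotic_refl _).
  - apply: boundedM; first by exact: (bounded_psi [::]).
    by rewrite -monomial_cat; exact: bounded_psi.
  - exact: bounded_cst.
  - exact/asymptotic_sym/psi_mul.
move=> e e0; near=> n; rewrite /psi_sum mulr_sumr.
by under [X in _ - X]eq_bigr do rewrite mulrA; rewrite subrr nrm0.
Unshelve. all: by end_near. Qed.

Lemma psi_sum_sqr (I : finType) (s : I -> seq L) (x : I -> A) : asymptotic
  (fun n => star (psi_sum s x n) * psi_sum s x n)
  (fun n => psi n (CG_cst 1) *
     psi_sum (fun ij : I * I => s ij.1 ++ s ij.2) (fun ij => star (x ij.1) * x ij.2) n).
Proof.
apply: asymptotic_trans (psi_sum_mul s s (star \o x) x).
apply: asymptoticM (psi_sum_star s x) (asymptotic_refl _); exact: bounded_psi_sum.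
Qed.

(** Each induction step squares by the C*-identity: N becomes 2 N, [delta] and [c] become their
    squares, the contraction psi(1) is dropped, and the numerical hypothesis keeps its form. At q =
    0 it remains to count letter types. *)
Lemma psi_sum_iterate (q N : nat) (I : finType) (s : I -> seq L) (x : I -> A)
    (delta c : R) : 0 <= delta -> 0 <= c ->
  (forall g, \sum_i mon (s i) g <= 1) ->
  (forall i, nrm (x i) <= delta) -> (forall i, (size (s i) <= N)%N) ->
  ((2 ^ q * N).+1 ^ #|L|)%:R * delta ^+ (2 ^ q) <= c ^+ (2 ^ q) ->
  limsup_le (psi_sum s x) c.
Proof.
elim: q N I s x delta c => [|q IH] N I s x delta c delta0 c0 s1 xd sN.
  rewrite expn0 mul1n !expr1 => h e e0; near=> n.
  apply: le_lt_trans (psi_sum_le_types n delta0 s1 xd sN) _.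
  by apply: le_lt_trans h _; rewrite ltrDl.
rewrite expnS !exprM => h; apply: limsup_le_sqr => //.
apply: limsup_le_asymptotic (psi_sum_sqr s x) _.
apply: limsup_le_contractM => [n|]; first exact: (nrm_psi_monomial n [::]).
apply: (IH (2 * N)%N _ _ _ (delta ^+ 2)) => [|||||].
- exact: sqr_ge0.
- exact: sqr_ge0.
- move=> g; under eq_bigr do rewrite monomial_cat CG_mulE.
  rewrite -(pair_big predT predT (fun i j => mon (s i) g * mon (s j) g)) /=.
  rewrite -big_distrlr /= mulr_ile1 // sumr_ge0 // => i _; exact: monomial_ge0.
- move=> [i j] /=; apply: le_trans (nrmM _ _) _; rewrite nrm_star expr2.
  by apply: ler_pM => //; exact: nrm_ge0.
- by move=> [i j]; rewrite size_cat mul2n -addnn leq_add.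
- by rewrite mulnCA mulnA.
Unshelve. all: by end_near. Qed.

(** The factor 2 absorbs the number of types: that number is at most 2^(2^q) for a suitable q, while
    [delta] enters to the power 2^q. *)
Lemma limsup_psi_sum (I : finType) (s : I -> seq L) (x : I -> A) (delta : R) :
  0 <= delta -> (forall g, \sum_i mon (s i) g <= 1) ->
  (forall i, nrm (x i) <= delta) -> limsup_le (psi_sum s x) (2 * delta).
Proof.
move=> d0 s1 xd; pose N := (\max_i size (s i))%N.
have [q hq] := types_vs_double_exponential N #|L|.
apply: (psi_sum_iterate (q := q) (N := N) (delta := delta)) => //.
- by rewrite mulr_ge0.
- by move=> i; exact: leq_bigmax.
- by rewrite exprMn ler_wpM2r ?exprn_ge0 // -natrX ler_nat.
Qed.

(** A coefficient whose monomial vanishes identically is multiplied by psi(0) = 0, so it may be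
    replaced by 0. *)
Lemma limsup_psi_sum_support (I : finType) (s : I -> seq L) (x : I -> A) (delta : R) :
  0 <= delta -> (forall g, \sum_i mon (s i) g <= 1) ->
  (forall i g, mon (s i) g != 0 -> nrm (x i) <= delta) ->
  limsup_le (psi_sum s x) (2 * delta).
Proof.
move=> d0 s1 xd.
pose x' i := if `[< exists g, mon (s i) g != 0 >] then x i else 0.
apply: (@limsup_le_asymptotic _ _ _ (psi_sum s x')); last first.
  apply: limsup_psi_sum => // i; rewrite /x'; case: asboolP => [[g]|_]; first exact: xd.
  by rewrite nrm0.
move=> e e0; near=> n; rewrite /psi_sum -sumrB big1 ?nrm0 // => i _.
rewrite /x'; case: asboolP => [_|no]; first by rewrite subrr.
have -> : mon (s i) = CG_mul (CG_cst 0) (mon (s i)).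
  apply/continuousEP => g; rewrite CG_mulE mul0r; apply/eqP/negPn/negP => h.
  by apply: no; exists g.
by rewrite (ccpZ (psi_ccp n)) scale0r !mul0r subrr.
Unshelve. all: by end_near. Qed.

Lemma psi_monomial_split (K : finType) (t : K -> seq L) n s :
  (forall g, \sum_k mon (t k) g = 1) ->
  psi n (mon s) = \sum_k psi n (mon (s ++ t k)).
Proof.
move=> t1; rewrite -(ccp_sum (psi_ccp n)); congr (psi n _); apply/continuousEP => g.
have -> : (\big[CG_add/CG_cst 0]_k mon (s ++ t k)) g = \sum_k mon (s ++ t k) g.
  by apply: (big_morph (fun f : CG R G => f g)).
under eq_bigr do rewrite monomial_cat CG_mulE.
by rewrite -mulr_sumr t1 mulr1.
Qed.

(** Both sums are rewritten over the common refinement of the two partitions of unity; this is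
    exact, by additivity of psi. *)
Lemma psi_sumB (I K : finType) (s : I -> seq L) (t : K -> seq L)
    (x : I -> A) (z : K -> A) n :
  (forall g, \sum_i mon (s i) g = 1) -> (forall g, \sum_k mon (t k) g = 1) ->
  psi_sum s x n - psi_sum t z n =
  psi_sum (fun ik : I * K => s ik.1 ++ t ik.2) (fun ik => x ik.1 - z ik.2) n.
Proof.
move=> s1 t1; rewrite /psi_sum.
under eq_bigr do rewrite (psi_monomial_split _ _ t1) mulr_suml.
under [X in _ - X]eq_bigr do rewrite (psi_monomial_split _ _ s1) mulr_suml.
rewrite [X in _ - X]exchange_big !pair_big /= -sumrB; apply: eq_bigr => -[i k] _ /=.
by rewrite mulrBr; congr (_ - psi n _ * _); rewrite !monomial_cat; apply/continuousEP => g;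
  rewrite !CG_mulE mulrC.
Qed.

(** On the common refinement, coefficients have to be compared only where both functions are nonzero
    at the same point. *)
Lemma limsup_psi_sumB (I K : finType) (s : I -> seq L) (t : K -> seq L)
    (x : I -> A) (z : K -> A) (delta : R) : 0 <= delta ->
  (forall g, \sum_i mon (s i) g = 1) -> (forall g, \sum_k mon (t k) g = 1) ->
  (forall i k g, mon (s i) g != 0 -> mon (t k) g != 0 -> nrm (x i - z k) <= delta) ->
  limsup_le (fun n => psi_sum s x n - psi_sum t z n) (2 * delta).
Proof.
move=> d0 s1 t1 xz.
apply: (@limsup_le_asymptotic _ _ _ (psi_sum (fun ik : I * K => s ik.1 ++ t ik.2)
  (fun ik => x ik.1 - z ik.2))).
  by move=> e e0; near=> n; rewrite psi_sumB // subrr nrm0.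
apply: limsup_psi_sum_support => // [g|[i k] g /=].
  under eq_bigr do rewrite monomial_cat CG_mulE.
  rewrite -(pair_big predT predT (fun i k => mon (s i) g * mon (t k) g)) /=.
  by rewrite -big_distrlr /= s1 t1 mulr1.
rewrite monomial_cat CG_mulE mulf_eq0 negb_or => /andP[]; exact: xz.
Unshelve. all: by end_near. Qed.

End KeyBound.

(** * Sequences of maps extracted from the Rokhlin property *)

Section RokhlinSequences.
Context {R : realType} {A : cstarType R} {G : topologicalGroupType}.
Context (alpha : G -> A -> A) (alpha_action : is_action alpha).
Context (alpha_Rokhlin : weak_tracial_Rokhlin_with_comparison alpha).

Lemma dense_sequence : separable A ->
  exists v : nat -> A, forall a (e : R), 0 < e -> exists k, nrm (a - v k) < e.
Proof.
move=> [D /countable_injP[f finj] Ddense].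
exists (fun k => xget 0 [set b | D b /\ f b = k]) => a e e0.
have a_e : nbhs a [set b | nrm (a - b) < e] by apply/nbhs_nrm; exists e.
have [|b [ab Db]] := Ddense _ _ (open_interior [set b | nrm (a - b) < e]).
  by exists a.
exists (f b); case: xgetP => [c _ [Dc cb]|/(_ b)]; last by case.
by rewrite (finj c b) ?inE //; exact: interior_subset ab.
Qed.

Lemma invn_small (e : R) : 0 < e -> \forall n \near \oo, (n.+1)%:R^-1 < e.
Proof.
move=> e0; have : @harmonic R @ \oo --> (0 : R) by exact: cvg_harmonic.
by move=> /cvgr_lt; apply.
Qed.

(** Stage n uses the tolerance 1 / (n + 1), the first n words in an enumeration of all words over
    [L], and the first n terms of a dense sequence of the algebra. *)
Lemma rokhlin_sequence (L : finType) (chi : L -> CG R G) (y : A) :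
  separable A -> (forall l g, 0 <= chi l g <= 1) ->
  positive (fixed_algebra alpha) y -> y != 0 ->
  exists (d : nat -> A) (psi : nat -> CG R G -> A),
  [/\ forall n, [/\ fixed_algebra alpha (d n), star (d n) = d n, nrm (d n) <= 1,
        contractive_cp_map (dAd_closure (d n)) (psi n) & psi n (CG_cst 1) = d n],
      forall s t, asymptotic
        (fun n => psi n (CG_cst 1) * psi n (CG_mul (monomial chi s) (monomial chi t)))
        (fun n => psi n (monomial chi s) * psi n (monomial chi t)),
      forall s a, asymptotic
        (fun n => psi n (monomial chi s) * a) (fun n => a * psi n (monomial chi s)),
      forall s (e : R), 0 < e -> \forall n \near \oo, forall g,
        nrm (psi n (Lt g (monomial chi s)) - alpha g (psi n (monomial chi s))) < e
    & forall n, cutdown_cuntz_sub (fixed_algebra alpha) (1 - d n) (n.+1)%:R^-1 y].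
Proof.
move=> sepA chi01 ypos y0; have [v vdense] := dense_sequence sepA.
(* Numbers that code no word are sent to the empty word. *)
pose mon := monomial chi; pose word k : seq L := odflt [::] (unpickle k).
have step n : exists dp : A * (CG R G -> A),
  [/\ [/\ fixed_algebra alpha dp.1, star dp.1 = dp.1, nrm dp.1 <= 1,
        contractive_cp_map (dAd_closure dp.1) dp.2 & dp.2 (CG_cst 1) = dp.1],
      forall i j, (i < n)%N -> (j < n)%N -> nrm (dp.2 (CG_cst 1) *
        dp.2 (CG_mul (mon (word i)) (mon (word j))) -
        dp.2 (mon (word i)) * dp.2 (mon (word j))) < (n.+1)%:R^-1,
      forall i k, (i < n)%N -> (k < n)%N ->
        nrm (dp.2 (mon (word i)) * v k - v k * dp.2 (mon (word i))) < (n.+1)%:R^-1,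
      forall i, (i < n)%N -> forall g,
        nrm (dp.2 (Lt g (mon (word i))) - alpha g (dp.2 (mon (word i)))) < (n.+1)%:R^-1
    & cutdown_cuntz_sub (fixed_algebra alpha) (1 - dp.1) (n.+1)%:R^-1 y].
  have n0 : 0 < (n.+1)%:R^-1 :> R by rewrite invr_gt0 ltr0n.
  have [||||//|//|d [psi [[dfix d1 ccp] [[[mul com equi] psi1] _ cut _ _]]]] :=
    alpha_Rokhlin (F := v @` `I_n) (S := (mon \o word) @` `I_n) (x := 1) (y := y) n0.
  - by apply: finite_image; exact: finite_II.
  - by apply: finite_image; exact: finite_II.
  - by exists 1; rewrite // star1 mulr1.
  - exact: nrm1.
  exists (d, psi); split=> //=.
  - split=> //; move: dfix => [x xfix ->]; last by rewrite starM starK.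
    by move=> g; rewrite (actM alpha_action) (act_star alpha_action) xfix.
  - by move=> i j ni nj; apply: mul; [exists i | exists j].
  - by move=> i k ni nk; apply: com; [exists i | exists k].
  - move=> i ni g; rewrite -lte_fin; apply: le_lt_trans (equi (mon (word i)) _).
      by apply: ereal_sup_ubound; exists g.
    by exists i.
have [dp hdp] := choice step.
have wordK s : word (pickle s) = s by rewrite /word pickleK.
have large (k : nat) (e : R) : 0 < e -> \forall n \near \oo, (k < n)%N /\ (n.+1)%:R^-1 < e.
  by move=> e0; near=> n; split; near: n; [exact: nbhs_infty_gt | exact: invn_small].
have mon_le1 s g : `|mon s g| <= (1 : R)%:C%C.
  rewrite monomialE normr_prod; apply: prodr_ile1 => l _.
  have /andP[l0 l1] := chi01 l g; rewrite normr_ge0 /= ger0_norm //.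
exists (fun n => (dp n).1), (fun n => (dp n).2); split=> [n|s t e e0|s a e e0|s e e0|n].
- by case: (hdp n).
- near=> n; have [_ mul _ _ _] := hdp n.
  rewrite -(wordK s) -(wordK t); apply: lt_trans (mul _ _ _ _) _.
  + by near: n; exact: nbhs_infty_gt.
  + by near: n; exact: nbhs_infty_gt.
  + by near: n; exact: invn_small.
(* Commutators are controlled only against the [v k]; a general [a] is approximated by one of them,
   and psi is contractive on monomials. *)
- have e3 : 0 < e / 3 by rewrite divr_gt0.
  have [k ak] := vdense a _ e3.
  near=> n; have [[_ _ _ ccp _] _ com _ _] := hdp n.
  have p1 : nrm ((dp n).2 (mon s)) <= 1 by exact (ccp_nrm_le ccp (mon_le1 s)).
  have : nrm ((dp n).2 (mon s) * v k - v k * (dp n).2 (mon s)) < e / 3.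
    rewrite -{1 2}(wordK s); apply: lt_trans (com _ _ _ _) _.
    + by near: n; exact: nbhs_infty_gt.
    + by near: n; exact: nbhs_infty_gt.
    + by near: n; exact: invn_small.
  set p := (dp n).2 (mon s) in p1 * => h.
  apply: le_lt_trans (nrm_triangle (p * v k) _ _) _.
  have := nrm_triangle (v k * p) (p * v k) (a * p).
  rewrite -mulrBr -mulrBl; have := nrmM p (a - v k); have := nrmM (v k - a) p.
  rewrite (nrmBC (v k) a).
  have : nrm p * nrm (a - v k) <= nrm (a - v k) by rewrite ler_piMl ?nrm_ge0.
  by rewrite (mulrC (nrm (a - v k))); lra.
- near=> n; have [_ _ _ equi _] := hdp n.
  move=> g; rewrite -(wordK s); apply: lt_trans (equi _ _ g) _.
  + by near: n; exact: nbhs_infty_gt.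
  + by near: n; exact: invn_small.
- by case: (hdp n).
Unshelve. all: by end_near. Qed.

End RokhlinSequences.

(** * Uniform continuity of translation, and partitions of unity on the compact group *)

Section PartitionsOfUnity.
Context {R : realType} {A : cstarType R} {G : topologicalGroupType}.
Context (alpha : G -> A -> A) (alpha_action : is_action alpha).
Context (G_compact : compact [set: G]).

(** The map (k, g) |-> f(k^-1 g) is jointly continuous, and compactness makes the estimate uniform
    in g. Near (h, g) the values at (k, g') and (h, g') are both compared with the one at (h, g),
    hence e / 2. *)
Lemma Lt_near (f : CG R G) (h : G) (e : R) : 0 < e ->
  \forall k \near h, forall g, `|Lt k f g - Lt h f g| < e%:C%C.
Proof.
move=> e0; pose V : normedModType R[i] := R[i]^o.
have e2 : 0 < (e / 2)%:C%C by rewrite ltcR divr_gt0.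
have transl : continuous (fun z : G * G => f (z.1^-1 * z.2)%g : V).
  move=> z; apply: (@continuous_comp _ _ _ (fun z : G * G => (z.1^-1 * z.2)%g) f);
    last exact: cts_fun.
  apply: (@continuous_comp _ _ _ (fun z : G * G => (z.1^-1%g, z.2))
    (fun x : G * G => (x.1 * x.2)%g)); last exact: mulg_continuous.
  apply: cvg_pair; last exact: cvg_snd.
  by apply: (@continuous_comp _ _ _ fst (fun x : G => x^-1%g));
    [exact: cvg_fst | exact: invg_continuous].
have near_z (z : G * G) : \forall w \near z,
    `|f (z.1^-1 * z.2)%g - f (w.1^-1 * w.2)%g| < (e / 2)%:C%C.
  apply: (@cvgr_dist_lt R[i] V _ (nbhs z) _ (fun w : G * G => f (w.1^-1 * w.2)%g)) => //.
  exact: transl.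
have : \forall k \near h, [set: G] `<=` (fun g => `|Lt k f g - Lt h f g| < e%:C%C).
  apply: ((compact_near_coveringP [set: G]).1 G_compact G (nbhs h)
    (fun k g => `|Lt k f g - Lt h f g| < e%:C%C)) => g _.
  have := near_z (h, g) => -[[U V'] /= [hU gV'] UV'].
  exists (V', U) => // -[g' k] /= [V'g' Uk].
  have h1 := UV' (k, g') (conj Uk V'g').
  have h2 := UV' (h, g') (conj (nbhs_singleton hU) V'g').
  rewrite /= in h1 h2; rewrite !LtE -[_ - _](subrKA (f (h^-1 * g)%g)).
  apply: le_lt_trans (ler_normD _ _) _; rewrite [X in X + _]distrC.
  by rewrite [e]splitr rmorphD /= ltrD.
by apply: filterS => k hk g; exact: hk.
Qed.

Lemma continuous_real_complex (r : G -> R) : continuous r ->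
  continuous (fun g => (r g)%:C%C : R[i]^o).
Proof.
move=> rc g; pose V : normedModType R[i] := R[i]^o.
apply/(@cvgrPdist_lt R[i] V _ (nbhs g) _ _ ((r g)%:C%C : V)) => -[e e'].
rewrite ltcE /= => /andP[/eqP -> e0].
have : \forall k \near g, `|r g - r k| < e by apply: cvgr_dist_lt => //; exact: rc.
apply: filterS => k; rewrite -rmorphB normc_def /= expr0n addr0 sqrtr_sqr => h.
by rewrite ltcR.
Qed.

Lemma continuous_orbit_dist a b : continuous (fun g => nrm (alpha g a - b)).
Proof.
move=> g; apply/cvgrPdist_lt => e e0.
have := @continuous_nrm _ _ _ (fun k => alpha k a) g e
  (@action_continuous _ _ _ _ alpha_action a) e0.
apply: filterS => k; apply: le_lt_trans; apply: le_trans (nrmB_abs _ _) _.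
by rewrite opprB subrKA.
Qed.

(** The bumps max(0, delta - rho i) come from the orbit distances themselves and are divided by
    their sum. Since [rho] adds the distances over all j, a nonzero bump bounds each of them by
    [delta]. *)
Lemma partition_of_unity (J : finType) (v : J -> A) (delta : R) : 0 < delta ->
  exists (n : nat) (p : 'I_n -> G) (f : 'I_n -> CG R G),
    [/\ forall i g, 0 <= f i g, forall g, \sum_i f i g = 1 &
        forall i g, f i g != 0 -> forall j,
          nrm (alpha g (v j) - alpha (p i) (v j)) <= delta].
Proof.
(* With |J| + 1 in the denominator, |J| distances below this radius sum to strictly less than
   [delta], so at every point some bump is positive; this also covers empty J. *)
move=> delta0; have e0 : 0 < delta / (#|J|.+1)%:R by rewrite divr_gt0.
have [n [p hp]] := orbit_net alpha_action G_compact v e0.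
pose rho i g := \sum_j nrm (alpha g (v j) - alpha (p i) (v j)).
pose r i g : R := Num.max 0 (delta - rho i g).
pose S g := \sum_i r i g.
have r0 i g : 0 <= r i g by rewrite le_max lexx.
have S0 g : 0 < S g.
  have [i hi] := hp g; rewrite /S (bigD1 i) //=.
  apply: ltr_pwDl; last by rewrite sumr_ge0.
  rewrite lt_max subr_gt0; apply/orP; right.
  apply: (@le_lt_trans _ _ (\sum_(j : J) delta / (#|J|.+1)%:R)).
    by apply: ler_sum => j _; rewrite nrmBC ltW.
  rewrite sumr_const -[ltLHS]mulr_natr mulrAC ltr_pdivrMr ?ltr0n // ltr_pM2l // ltr_nat.
  by rewrite ltnS leqnn.
have rcont i : continuous (r i).
  have -> : r i = (cst 0) \max (fun g => delta - rho i g) by [].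
  apply: max_fun_continuous; first exact: cst_continuous.
  move=> g; apply: cvgB; first exact: cvg_cst.
  by apply: continuous_big => [|j _]; [exact: add_continuous | exact: continuous_orbit_dist].
have Scont : continuous S.
  by apply: continuous_big => [|i _]; [exact: add_continuous | exact: rcont].
have fcont i : continuous (fun g => (r i g / S g)%:C%C : R[i]^o).
  apply: continuous_real_complex => g; apply: cvgM; first exact: rcont.
  by apply: cvgV; [rewrite gt_eqF | exact: Scont].
exists n, p, (fun i => mkcts (fcont i)); split=> [i g|g|i g fi j].
- by rewrite /= lecR divr_ge0 // ltW.
- rewrite /= -(rmorph_sum (real_complex R)) -mulr_suml mulfV ?rmorph1 //.
  by rewrite gt_eqF //; exact: S0.
- have : r i g != 0.
    by apply: contra_neq fi => ri0; rewrite -[LHS]/((r i g / S g)%:C%C) ri0 mul0r.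
  rewrite /r maxEle; case: ifP => [rho_le _|]; last by rewrite eqxx.
  apply: (@le_trans _ _ (rho i g)); last by rewrite -subr_ge0.
  by rewrite /rho (bigD1 j) //= lerDl sumr_ge0 // => k _; exact: nrm_ge0.
Qed.

End PartitionsOfUnity.

(** * The averaging maps [T] attached to a partition of unity *)

Section AveragingMaps.
Context {R : realType} {A : cstarType R} {G : topologicalGroupType}.
Context (alpha : G -> A -> A) (alpha_action : is_action alpha).
Context (alpha_Rokhlin : weak_tracial_Rokhlin_with_comparison alpha).
Context (G_compact : compact [set: G]) (A_separable : separable A).

(** [T] is a [psi_sum] with one-letter words f i and coefficients alpha (p i) a, at a late stage of
    a Rokhlin sequence. Additivity and T 1 = d hold at every stage; the estimates are finitely many
    asymptotic bounds, which hold together from some stage on. *)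
Lemma averaging_map (J : finType) (v : J -> A) (y : A) (delta : R) :
  positive (fixed_algebra alpha) y -> y != 0 -> 0 < delta ->
  exists (d : A) (T : A -> A) (eps : R),
  [/\ [/\ fixed_algebra alpha d, star d = d & nrm d <= 1],
      [/\ 0 < eps, eps <= delta &
        cutdown_cuntz_sub (fixed_algebra alpha) (1 - d) eps y] &
      {morph T : a b / a + b} /\ T 1 = d] /\
  [/\ forall j, nrm (T (v j)) <= 2 * nrm (v j) + delta,
      forall i j, nrm (T (v i) * y * T (v j) - d * T (v i * y * v j))
        <= 4 * delta * (nrm y * (nrm (v i) + nrm (v j))) + delta &
      forall j g, nrm (alpha g (T (v j)) - T (v j)) <= 5 * delta].
Proof.
move=> ypos y0 delta0.
have yfix : fixed_algebra alpha y.
  by move: ypos => [z zfix ->] g; rewrite (actM alpha_action) (act_star alpha_action) zfix.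
have [n [p [f [f0 f1 fp]]]] := partition_of_unity alpha_action G_compact v delta0.
pose V := \sum_j nrm (v j).
have vV j : nrm (v j) <= V.
  by rewrite /V (bigD1 j) //= lerDl sumr_ge0 // => k _; exact: nrm_ge0.
have V0 : 0 <= V by rewrite sumr_ge0 // => j _; exact: nrm_ge0.
(* In [T_equi] n errors of size eta (2 V + 1) are added, and should total at most delta / 2; n + 1
   avoids a zero denominator. *)
pose eta : R := delta / (2 * n.+1%:R * (2 * V + 1)).
have etaE : n.+1%:R * (eta * (2 * V + 1)) = delta / 2.
  rewrite /eta; have : 2 * V + 1 != 0 by rewrite gt_eqF //; lra.
  have : n.+1%:R != 0 :> R by rewrite pnatr_eq0.
  by set n1 := n.+1%:R; set W := 2 * V + 1 => ? ?; field; apply/andP.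
have eta0 : 0 < eta.
  by rewrite divr_gt0 // mulr_gt0 ?mulr_gt0 ?ltr0n //; lra.
(* The Rokhlin sequence handles a finite alphabet only, so the translates of the f i by arbitrary g
   are replaced by those by net points, which approximate the moved coefficients as well. *)
have [m [h hnet]] : exists m (h : 'I_m -> G), forall g, exists k,
    (forall i, forall g', `|Lt g (f i) g' - Lt (h k) (f i) g'| < eta%:C%C) /\
    (forall i j, nrm (alpha (h k) (alpha (p i) (v j)) - alpha g (alpha (p i) (v j))) < eta).
  apply: (compact_net G_compact (E := fun q g =>
    (forall i, forall g', `|Lt g (f i) g' - Lt q (f i) g'| < eta%:C%C) /\
    (forall i j, nrm (alpha q (alpha (p i) (v j)) - alpha g (alpha (p i) (v j))) < eta))).
  move=> q; apply: filterI.
    by apply: filter_forall => i; exact: Lt_near.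
  apply: filter_forall => i; apply: filter_forall => j.
  have := @continuous_nrm _ _ _ (fun k => alpha k (alpha (p i) (v j))) q eta.
  by apply => //; exact: (@action_continuous _ _ _ _ alpha_action).
pose L : finType := ('I_n + 'I_n * 'I_m)%type.
pose chi (l : L) : CG R G :=
  match l with inl i => f i | inr (i, k) => Lt (h k) (f i) end.
have f01 i g : 0 <= f i g <= 1.
  rewrite f0 /= -(f1 g) (bigD1 i) //= lerDl sumr_ge0 // => j _; exact: f0.
have chi01 l g : 0 <= chi l g <= 1 by case: l => [i|[i k]] /=; exact: f01.
have [d [psi [hd psi_mul psi_comm psi_equi cut]]] :=
  rokhlin_sequence alpha_action alpha_Rokhlin A_separable chi01 ypos y0.
have psi_ccp N : contractive_cp_map (dAd_closure (d N)) (psi N) by case: (hd N).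
have psi1 N : psi N (CG_cst 1) = d N by case: (hd N).
pose mon := monomial chi.
have mon1 l : mon [:: l] = chi l.
  by apply/continuousEP => g; rewrite /mon monomialE big_seq1.
pose w i : seq L := [:: inl i].
pose wh k i : seq L := [:: inr (i, k)].
have w_sum g : \sum_i mon (w i) g = 1 by under eq_bigr do rewrite mon1; exact: f1.
have wh_sum k g : \sum_i mon (wh k i) g = 1 by under eq_bigr do rewrite mon1 LtE; exact: f1.
pose T N a := psi_sum psi chi w (fun i => alpha (p i) a) N.
have supp i g j : mon (w i) g != 0 -> nrm (alpha g (v j) - alpha (p i) (v j)) <= delta.
  by rewrite mon1 => /fp; apply.
have T_norm j : limsup_le (T^~ (v j)) (2 * nrm (v j)).
  apply: (limsup_psi_sum psi_ccp chi01 psi_mul psi_comm); first exact: nrm_ge0.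
    by move=> g; rewrite w_sum.
  by move=> i; rewrite (nrm_act alpha_action).
(* The product is a sum over pairs, compared with T (v i * y * v j) by [limsup_psi_sumB]. Where the
   functions of indices a, b, c are nonzero at one g, the orbit points for p a, p b and p c are
   within 2 delta of each other, and y does not move as it is fixed. *)
have T_mul i j : limsup_le
    (fun N => T N (v i) * y * T N (v j) - d N * T N (v i * y * v j))
    (2 * (2 * delta * (nrm y * (nrm (v i) + nrm (v j))))).
  have TyT := psi_sum_mul psi_ccp chi01 psi_mul psi_comm w w
    (fun l => alpha (p l) (v i) * y) (fun l => alpha (p l) (v j)).
  have lim : limsup_le (fun N => psi N (CG_cst 1) * (psi_sum psi chi
      (fun ik : 'I_n * 'I_n => w ik.1 ++ w ik.2)
      (fun ik => alpha (p ik.1) (v i) * y * alpha (p ik.2) (v j)) N -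
      T N (v i * y * v j))) (2 * (2 * delta * (nrm y * (nrm (v i) + nrm (v j))))).
    apply: limsup_le_contractM => [N|]; first by rewrite psi1; case: (hd N).
    apply: (limsup_psi_sumB psi_ccp chi01 psi_mul psi_comm).
    - by rewrite !mulr_ge0 ?addr_ge0 ?nrm_ge0 // ltW.
    - move=> g; under eq_bigr do rewrite monomial_cat CG_mulE.
      rewrite -(pair_big predT predT (fun i k => mon (w i) g * mon (w k) g)) /=.
      by rewrite -big_distrlr /= w_sum mulr1.
    - exact: w_sum.
    move=> [a b] c g; rewrite monomial_cat CG_mulE mulf_eq0 negb_or => /andP[ga gb] gc.
    rewrite /fst /snd in ga gb *.
    have near_c a' j' : mon (w a') g != 0 ->
        nrm (alpha (p a') (v j') - alpha (p c) (v j')) <= 2 * delta.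
      move=> ga'; have := supp a' g j' ga'; have := supp c g j' gc.
      have := nrm_triangle (alpha g (v j')) (alpha (p a') (v j')) (alpha (p c) (v j')).
      by rewrite (nrmBC (alpha (p a') (v j')) (alpha g (v j'))); lra.
    rewrite !(actM alpha_action) yfix -!mulrA mul_subC -mulrBr.
    apply: le_trans (nrmD _ _) _.
    have := nrmM (alpha (p a) (v i) - alpha (p c) (v i)) (y * alpha (p b) (v j)).
    have := nrmM (alpha (p c) (v i)) (y * (alpha (p b) (v j) - alpha (p c) (v j))).
    have := ler_pM (nrm_ge0 _) (nrm_ge0 _) (near_c a i ga) (nrmM y (alpha (p b) (v j))).
    have := ler_wpM2l (nrm_ge0 (alpha (p c) (v i))) (le_trans (nrmM y _)
      (ler_wpM2l (nrm_ge0 y) (near_c b j gb))).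
    rewrite !nrm_act //; lra.
  move: lim; apply: limsup_le_asymptotic => e e0.
  apply: filterS (TyT e e0) => N; rewrite -psi1 /T.
  have -> : psi_sum psi chi w (fun i0 => alpha (p i0) (v i)) N * y =
      psi_sum psi chi w (fun l => alpha (p l) (v i) * y) N.
    by rewrite /psi_sum mulr_suml; apply: eq_bigr => l _; rewrite mulrA.
  by rewrite mulrBr opprB addrA addrNK.
(* Let X be T (v j) with its functions and coefficients translated by a net point h k near g. Then
   alpha g (T (v j)) is within delta / 2 of X, and X within 4 delta + delta / 2 of T (v j). *)
have T_equi j : \forall N \near \oo, forall g,
    nrm (alpha g (T N (v j)) - T N (v j)) <= 5 * delta.
  have lim k : limsup_le (fun N =>
      psi_sum psi chi (wh k) (fun i => alpha (h k) (alpha (p i) (v j))) N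
      - T N (v j)) (2 * (2 * delta)).
    apply: (limsup_psi_sumB psi_ccp chi01 psi_mul psi_comm) => //.
    - by rewrite mulr_ge0 // ltW.
    move=> i i' g; rewrite -[monomial chi (wh k i)]/(mon [:: inr (i, k)]) mon1 LtE.
    move=> /fp/(_ j) h1 /(supp i' g j) h2.
    have := nrm_triangle (alpha g (v j)) (alpha (h k) (alpha (p i) (v j)))
      (alpha (p i') (v j)).
    (* The bound holds at the point (h k)^-1 g; the isometry alpha (h k) carries it to g. *)
    rewrite nrmBC -(nrm_act alpha_action (h k)) (actB alpha_action) in h1.
    rewrite -(action_mul alpha_action _ (_ * g)%g) mulgA mulgV mul1g in h1.
    move: h1 h2; lra.
  have delta2 : 0 < delta / 2 by rewrite divr_gt0.
  have lims : \forall N \near \oo, forall k, nrm (psi_sum psi chi (wh k)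
      (fun i => alpha (h k) (alpha (p i) (v j))) N - T N (v j)) < 2 * (2 * delta) + delta / 2.
    by apply: filter_forall => k; exact: lim.
  have equis : \forall N \near \oo, forall i g,
      nrm (psi N (Lt g (mon (w i))) - alpha g (psi N (mon (w i)))) < eta.
    by apply: filter_forall => i; exact: psi_equi.
  move: lims equis; apply: filterS2 => N limN equiN g; have [k [hk1 hk2]] := hnet g.
  set X := psi_sum psi chi (wh k) (fun i => alpha (h k) (alpha (p i) (v j))) N.
  have close : nrm (alpha g (T N (v j)) - X) <= delta / 2.
    rewrite /T /X /psi_sum (act_sum alpha_action) -sumrB.
    apply: le_trans (nrm_sum _ _ _) _; rewrite -etaE.
    apply: (@le_trans _ _ (\sum_(i < n) eta * (2 * V + 1))).
      apply: ler_sum => i _; rewrite (actM alpha_action) mul_subC.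
      apply: le_trans (nrmD _ _) _.
      set u := alpha g (psi N _); set u' := psi N _.
      (* One [eta] is for approximate equivariance of psi, the other for replacing g by h k. *)
      have uu' : nrm (u - u') <= 2 * eta.
        have := nrm_triangle (psi N (Lt g (mon (w i)))) u u'.
        have := equiN i g; rewrite nrmBC -/u.
        have : nrm (psi N (Lt g (mon (w i))) - u') <= eta.
          apply: (@ccp_nrmB_le R A G _ _ (psi_ccp N)) => g'.
          by rewrite mon1 -[monomial _ _]/(mon [:: inr (i, k)]) mon1; exact/ltW/hk1.
        by lra.
      have u'1 : nrm u' <= 1.
        exact (nrm_psi_monomial psi_ccp chi01 N (wh k i)).
      have := nrmM (u - u') (alpha g (alpha (p i) (v j))).
      have := nrmM u' (alpha g (alpha (p i) (v j)) - alpha (h k) (alpha (p i) (v j))).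
      rewrite nrmBC !(nrm_act alpha_action) => ha hb.
      have := ler_pM (nrm_ge0 _) (nrm_ge0 _) uu' (vV j).
      have := ler_pM (nrm_ge0 _) (nrm_ge0 _) u'1 (ltW (hk2 i j)).
      move: ha hb; lra.
    rewrite sumr_const card_ord -[leLHS]mulr_natl ler_wpM2r ?ler_nat //.
    by rewrite mulr_ge0 ?ltW //; lra.
  have := nrm_triangle X (alpha g (T N (v j))) (T N (v j)).
  have := limN k; rewrite -/X; move: close; lra.
pose near_all (N : nat) :=
  [/\ forall j, nrm (T N (v j)) < 2 * nrm (v j) + delta,
      forall i j, nrm (T N (v i) * y * T N (v j) - d N * T N (v i * y * v j))
        < 2 * (2 * delta * (nrm y * (nrm (v i) + nrm (v j)))) + delta,
      forall j g, nrm (alpha g (T N (v j)) - T N (v j)) <= 5 * delta &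
      N.+1%:R^-1 < delta].
have : \forall N \near \oo, near_all N.
  near=> N; split; near: N.
  - by apply: filter_forall => j; exact: T_norm.
  - by apply: filter_forall => i; apply: filter_forall => j; exact: T_mul.
  - by apply: filter_forall => j; exact: T_equi.
  - exact: invn_small.
move=> [N _ /(_ N (leqnn N)) [Tn Tm Te Ns]].
have [dfix sd d1 _ _] := hd N.
exists (d N), (T N), N.+1%:R^-1; split; split.
- by split.
- by split; [rewrite invr_gt0 ltr0n | exact: ltW | exact: cut].
- split=> [a b|].
    rewrite /T /psi_sum -big_split; apply: eq_bigr => i _ /=.
    by rewrite (actD alpha_action) mulrDr.
  rewrite -psi1 -[CG_cst 1]/(mon [::]) (psi_monomial_split psi_ccp _ _ w_sum).
  by apply: eq_bigr => i _; rewrite (act_one alpha_action) mulr1.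
- by move=> j; exact: ltW.
- move=> i j; apply: le_trans (ltW (Tm i j)) _; lra.
- exact: Te.
Unshelve. all: by end_near. Qed.

End AveragingMaps.

(** * Closed ideals: membership of the unit, and generation by one element *)

Section Ideals.
Context {R : realType} {A : cstarType R}.
Implicit Types (a b u y : A) (B I : set A).

Lemma ideal_add B I a b : closed_ideal B I -> I a -> I b -> I (a + b).
Proof. by move=> [_ _ _ lin _] Ia Ib; rewrite -(scale1r a); exact: lin. Qed.

Lemma ideal_sub B I a b : closed_ideal B I -> I a -> I b -> I (a - b).
Proof.
by move=> [_ _ _ lin _] Ia Ib; rewrite addrC -(scaleN1r b); exact: lin.
Qed.

Lemma ideal_sum B I (J : Type) (r : seq J) (F : J -> A) : closed_ideal B I ->
  (forall j, I (F j)) -> I (\sum_(j <- r) F j).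
Proof.
move=> idI IF; apply: (big_ind I) => //; first by case: idI.
by move=> a b; exact: ideal_add idI.
Qed.

(** Modulo the ideal every power (1 - u)^n is 1, and these powers tend to 0; so 1 is a limit of
    elements of the ideal. *)
Lemma ideal_one B I u : closed_ideal B I -> I u -> nrm (1 - u) < 1 -> I 1.
Proof.
move=> idI Iu u1; have [IB Iclosed I0 _ mulI] := idI.
have pow n : exists2 w, I w & (1 - u) ^+ n = 1 - w.
  elim: n => [|n [w Iw wE]]; first by exists 0; rewrite // expr0 subr0.
  exists (u + w - w * u); last first.
    rewrite exprSr wE mulrBl mul1r mulrBr mulr1 -addrA -opprD; congr (1 - _).
    by rewrite addrA.
  apply: ideal_sub idI (ideal_add idI Iu Iw) _.
  exact: (mulI _ _ (IB _ Iw) Iu).1.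
apply: (closed_nrm I).1 => // e e0.
have q01 : 0 <= nrm (1 - u) < 1 by rewrite nrm_ge0.
have [n _ /(_ n (leqnn n)) /= small] := geometric_small 1 q01 e0.
have [w Iw wE] := pow n; exists w => //.
by rewrite -wE; apply: le_lt_trans (nrmX _ _) _; rewrite mul1r in small.
Qed.

(** The limits of sums of terms a y b form a closed ideal containing y = 1 y 1, hence the whole
    algebra. *)
Lemma simple_approximate_unit y (e : R) : simple_cstar [set: A] -> y != 0 -> 0 < e ->
  exists (m : nat) (a b : 'I_m -> A), nrm (1 - \sum_k a k * y * b k) < e.
Proof.
move=> [_ simpleA] y0 e0.
pose S (l : seq (A * A)) := \sum_(p <- l) p.1 * y * p.2.
pose I : set A := [set x | forall e : R, 0 < e -> exists l, nrm (x - S l) < e].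
have idI : closed_ideal [set: A] I.
  split=> //.
  - apply/closed_nrm => x hx e1 e10; have e2 : 0 < e1 / 2 by rewrite divr_gt0.
    have [x' /(_ _ e2)[l hl] xx'] := hx _ e2.
    by exists l; have := nrm_triangle x' x (S l); lra.
  - by move=> e1 e10; exists [::]; rewrite /S big_nil subrr nrm0.
  - move=> z a b Ia Ib e1 e10; pose r := complex.Re `|z|.
    have r0 : 0 <= r by have := normr_ge0 z; rewrite lecE => /andP[].
    have er : 0 < e1 / (2 * (r + 1)) by rewrite divr_gt0 // mulr_gt0 //; lra.
    have e2 : 0 < e1 / 2 by rewrite divr_gt0.
    have [l hl] := Ia _ er; have [l' hl'] := Ib _ e2.
    exists ([seq (z *: p.1, p.2) | p <- l] ++ l').
    have -> : S ([seq (z *: p.1, p.2) | p <- l] ++ l') = z *: S l + S l'.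
      rewrite /S big_cat big_map scaler_sumr; congr (_ + _).
      by apply: eq_bigr => p _ /=; rewrite -!scalerAl.
    rewrite opprD addrACA -scalerBr; apply: le_lt_trans (nrmD _ _) _.
    rewrite nrmZ -/r.
    have : r * nrm (a - S l) <= r * (e1 / (2 * (r + 1))) by rewrite ler_wpM2l // ltW.
    have : (r + 1) * (e1 / (2 * (r + 1))) = e1 / 2 by field; apply/eqP; lra.
    by rewrite mulrDl mul1r; lra.
  - move=> b x _ Ix; split=> e1 e10.
      have eb : 0 < e1 / (nrm b + 1) by rewrite divr_gt0 // ltr_wpDl ?nrm_ge0.
      have [l hl] := Ix _ eb; exists [seq (b * p.1, p.2) | p <- l].
      have -> : S [seq (b * p.1, p.2) | p <- l] = b * S l.
        by rewrite /S big_map mulr_sumr; apply: eq_bigr => p _ /=; rewrite !mulrA.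
      rewrite -mulrBr; apply: le_lt_trans (nrmM _ _) _.
      move: hl; rewrite ltr_pdivlMr ?ltr_wpDl ?nrm_ge0 // => hl.
      apply: le_lt_trans hl; rewrite mulrC ler_wpM2l ?nrm_ge0 //; lra.
    have eb : 0 < e1 / (nrm b + 1) by rewrite divr_gt0 // ltr_wpDl ?nrm_ge0.
    have [l hl] := Ix _ eb; exists [seq (p.1, p.2 * b) | p <- l].
    have -> : S [seq (p.1, p.2 * b) | p <- l] = S l * b.
      by rewrite /S big_map mulr_suml; apply: eq_bigr => p _ /=; rewrite !mulrA.
    rewrite -mulrBl; apply: le_lt_trans (nrmM _ _) _.
    move: hl; rewrite ltr_pdivlMr ?ltr_wpDl ?nrm_ge0 // => hl.
    apply: le_lt_trans hl; rewrite ler_wpM2l ?nrm_ge0 //; lra.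
have Iy : I y.
  by move=> e1 e10; exists [:: (1, 1)]; rewrite /S big_seq1 mul1r mulr1 subrr nrm0.
have I1 : I 1.
  have [I0|->//] := simpleA _ idI.
  by move: Iy; rewrite I0 /= => y0'; rewrite y0' eqxx in y0.
have [l hl] := I1 e e0.
exists (size l), (fun k => (tnth (in_tuple l) k).1), (fun k => (tnth (in_tuple l) k).2).
by move: hl; rewrite /S (big_tnth _ _ l).
Qed.

End Ideals.

(** * Choice of constants, and the unit in every nonzero closed ideal *)

Theorem theorem4p1 (R : realType) (A : cstarType R) (G : topologicalGroupType)
    (alpha : G -> A -> A)
    (A_simple : simple_cstar [set: A])
    (A_separable : separable A)
    (A_infinite_dimensional : infinite_dimensional A)
    (G_compact : compact [set: G])
    (G_hausdorff : hausdorff_space G)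
    (G_second_countable : @second_countable G)
    (alpha_action : is_action alpha)
    (alpha_Rokhlin : weak_tracial_Rokhlin_with_comparison alpha) :
  simple_cstar (fixed_algebra alpha).
Proof.
have fix1 : fixed_algebra alpha 1 by move=> g; exact: act_one alpha_action g.
have fixM a b : fixed_algebra alpha a -> fixed_algebra alpha b -> fixed_algebra alpha (a * b).
  by move=> fa fb g; rewrite (actM alpha_action) fa fb.
have fix_star a : fixed_algebra alpha a -> fixed_algebra alpha (star a).
  by move=> fa g; rewrite (act_star alpha_action) fa.
split.
  apply/eqP => F0; have := fix1; rewrite F0 /= => /eqP; by rewrite oner_eq0.
move=> I idI; have [IB Iclosed I0 _ mulI] := idI.
have [[z Iz z0]|noz] := pselect (exists2 z, I z & z != 0); last first.
  left; apply/seteqP; split=> [x Ix|x ->//] /=.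
  by apply/eqP/negPn/negP => x0; apply: noz; exists x.
right; apply/seteqP; split=> // b Bb.
suff I1 : I 1 by rewrite -(mulr1 b); exact: (mulI _ _ Bb I1).1.
pose y := star z * z.
have Iy : I y by apply: (mulI _ _ _ Iz).1; exact/fix_star/IB.
have ypos : positive (fixed_algebra alpha) y by exists z => //; exact: IB.
have y0 : y != 0.
  apply: contra_neq z0 => yz; apply: nrm0_eq0; apply/eqP.
  by rewrite -sqrf_eq0 -nrm_starM -/y yz nrm0.
have e0 : 0 < 16^-1 :> R by rewrite invr_gt0 ltr0n.
have [m [a [c hW]]] := simple_approximate_unit A_simple y0 e0.
set W := 1 - _ in hW.
(* One constant, at least 1, dominates all norms that enter the estimates. *)
pose M := 1 + nrm y + \sum_k (nrm (a k) + nrm (c k)).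
have sum0 : 0 <= \sum_k (nrm (a k) + nrm (c k)).
  by rewrite sumr_ge0 // => k _; rewrite addr_ge0 ?nrm_ge0.
have acM k : nrm (a k) + nrm (c k) <= M.
  have : nrm (a k) + nrm (c k) <= \sum_k (nrm (a k) + nrm (c k)).
    rewrite [leRHS](bigD1 k) //= lerDl sumr_ge0 // => j _.
    by rewrite addr_ge0 ?nrm_ge0.
  by have := nrm_ge0 y; rewrite /M; lra.
have yM : nrm y <= M by rewrite /M; lra.
have M1 : 1 <= M by have := nrm_ge0 y; rewrite /M; lra.
(* Each of the m terms below costs at most (5 + 30 + 30) M^2 delta, well within 169 M^2 delta;
   [delta] is then chosen so that delta N = 1/16. *)
pose N : R := 169 * M ^+ 2 * m.+1%:R.
have N1 : 1 <= N.
  have m1 : 1 <= m.+1%:R :> R by rewrite ler1n.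
  have M2 : 1 <= M ^+ 2 by rewrite exprn_ege1.
  by rewrite /N; nra.
pose delta : R := (16 * N)^-1.
have delta0 : 0 < delta by rewrite invr_gt0; lra.
have deltaN : delta * N = 16^-1 by rewrite /delta; field; apply/eqP; lra.
have delta16 : delta <= 16^-1 by rewrite -deltaN ler_peMr // ltW.
(* The remainder [W] joins the a's and c's, so that the norm of T W is controlled too. *)
pose v (j : option ('I_m + 'I_m)) :=
  match j with None => W | Some (inl k) => a k | Some (inr k) => c k end.
have [d [T [eps [[[dfix sd d1] [eps0 epsd cut] [TD T1]] [Tn Tm Te]]]]] :=
  averaging_map alpha_action alpha_Rokhlin G_compact A_separable v ypos y0 delta0.
have T0 : T 0 = 0 by apply: (@addrI _ (T 0)); rewrite -TD !addr0.
have near_fixed j : exists x, fixed_algebra alpha x /\ nrm (T (v j) - x) <= 10 * delta.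
  have [|x fx hx] := fixed_point_near alpha_action G_compact (b := T (v j))
    (D := 5 * delta) _ (Te j).
    by rewrite mulr_gt0.
  by exists x; split=> //; lra.
have /choice[t ht] := near_fixed.
have [q cq subq] := cut.
have Iq : I q by exact: cuntz_sub_ideal fix_star idI Iy subq.
have dq := nrm_cutdown sd d1 eps0 cq.
pose s := \sum_k t (Some (inl k)) * y * t (Some (inr k)).
have Is : I s.
  apply: ideal_sum idI _ => k.
  apply: (mulI _ _ (ht _).1 _).2; exact: (mulI _ _ (ht _).1 Iy).1.
have Iqd : I (q * (1 + d)).
  apply: (mulI _ _ _ Iq).2 => g; rewrite (actD alpha_action) fix1 dfix //.
apply: ideal_one idI (ideal_add idI Iqd Is) _.
(* This is d T(1), with 1 written as W plus the sum of the a y c and T additive. *)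
have ddE : d * d = d * T W + \sum_k d * T (a k * y * c k).
  rewrite -mulr_sumr -mulrDr -{2}T1; congr (d * _).
  rewrite -(big_morph T TD T0) -TD; congr (T _).
  by rewrite /W subrK.
have term k : nrm (d * T (a k * y * c k) - t (Some (inl k)) * y * t (Some (inr k)))
    <= 169 * M ^+ 2 * delta.
  have [_ ta] := ht (Some (inl k)); have [_ tc] := ht (Some (inr k)).
  have := Tm (Some (inl k)) (Some (inr k)).
  have := Tn (Some (inl k)); have := Tn (Some (inr k)).
  rewrite /v in ta tc *.
  set x1 := T (a k) in ta *; set x2 := T (c k) in tc *.
  set t1 := t _ in ta *; set t2 := t _ in tc *; set x := d * T _.
  move=> x2n x1n xx; have := acM k => acMk.
  have a0 := nrm_ge0 (a k); have c0 := nrm_ge0 (c k).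
  have x2M : nrm x2 <= 3 * M by lra.
  have t1M : nrm t1 <= 3 * M by have := nrmB x1 (x1 - t1); rewrite subKr; lra.
  have h1 : nrm ((x1 - t1) * y * x2) <= 10 * delta * M * (3 * M).
    apply: le_trans (nrmM _ _) _; apply: ler_pM; rewrite ?nrm_ge0 //.
    by apply: le_trans (nrmM _ _) _; apply: ler_pM; rewrite ?nrm_ge0.
  have h2 : nrm (t1 * y * (x2 - t2)) <= 3 * M * M * (10 * delta).
    apply: le_trans (nrmM _ _) _; apply: ler_pM; rewrite ?nrm_ge0 //.
    by apply: le_trans (nrmM _ _) _; apply: ler_pM; rewrite ?nrm_ge0.
  have yac : nrm y * (nrm (a k) + nrm (c k)) <= M * M.
    by apply: ler_pM; rewrite ?addr_ge0 ?nrm_ge0.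
  have h3 : 4 * delta * (nrm y * (nrm (a k) + nrm (c k))) <= 4 * delta * (M * M).
    by apply: ler_wpM2l => //; lra.
  have M2 : delta <= M ^+ 2 * delta by rewrite ler_peMl ?exprn_ege1 // ltW.
  apply: le_trans (nrm_triangle (x1 * y * x2) _ _) _; rewrite (nrmBC x).
  have -> : x1 * y * x2 - t1 * y * t2 = (x1 - t1) * y * x2 + t1 * y * (x2 - t2).
    by rewrite mul_subC -mulrBl.
  have := nrmD ((x1 - t1) * y * x2) (t1 * y * (x2 - t2)).
  by move: h1 h2 h3 xx M2; rewrite expr2; nra.
(* T W contributes 2/16 + delta <= 3/16, and the terms of the sum 1/16. *)
have dds : nrm (d * d - s) <= 4^-1.
  rewrite ddE -addrA -sumrB; apply: le_trans (nrmD _ _) _.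
  have h1 : nrm (d * T W) <= 3 / 16.
    apply: le_trans (nrmM _ _) _.
    have := ler_wpM2r (nrm_ge0 (T W)) d1; have := Tn None; rewrite /v; lra.
  have h2 : nrm (\sum_(k < m) (d * T (a k * y * c k) -
      t (Some (inl k)) * y * t (Some (inr k)))) <= 16^-1.
    apply: le_trans (nrm_sum _ _ _) _; apply: le_trans (ler_sum _ (fun k _ => term k)) _.
    rewrite sumr_const card_ord -[leLHS]mulr_natl -deltaN /N.
    set K := 169 * M ^+ 2 * delta.
    have -> : delta * (169 * M ^+ 2 * m.+1%:R) = m%:R * K + K by rewrite -natr1 /K; ring.
    by rewrite lerDl /K; apply: mulr_ge0; [apply: mulr_ge0 => //; exact: sqr_ge0 | exact: ltW].
  lra.
(* The first product is at most 2 eps <= 1/8 in norm, since ||1 + d|| <= 2; the total is at most 3/8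
   < 1. *)
have -> : 1 - (q * (1 + d) + s) = (1 - d - q) * (1 + d) + (d * d - s).
  have dd : (1 - d) * (1 + d) = 1 - d * d.
    by rewrite mulrDr mulr1 mulrBl mul1r addrA subrK.
  by rewrite mulrBl dd [1 - d * d - _]addrAC subrKA opprD addrA.
apply: le_lt_trans (nrmD _ _) _.
have := nrmM (1 - d - q) (1 + d); have := nrmD 1 d; rewrite nrm1.
have : nrm (1 - d - q) * nrm (1 + d) <= eps * nrm (1 + d) by rewrite ler_wpM2r ?nrm_ge0.
have := nrm_ge0 (1 + d); nra.
Qed.
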